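(* Let $G \leq \mathrm{Homeo}(\mathbb{S}^1)$ be a group of homeomorphisms of the circle whose action on $\mathbb{S}^1$ is minimal, proximal, and not topologically free. Let $G^+ := G \cap \mathrm{Homeo}^+(\mathbb{S}^1)$ and assume that distinct points of $\mathbb{S}^1$ have distinct stabilizers in $G^+$ (i.e. the map $z \mapsto G^+_z$ is injective on $\mathbb{S}^1$). Then for every faithful, $3$-transitive action of $G$ on a set $\Omega$, there exists a $G$-orbit $\mathcal{O} \subset \mathbb{S}^1$ such that the action of $G$ on $\Omega$ is conjugate to the action of $G$ on $\mathcal{O}$.
   Context: $\mathrm{Homeo}^+(\mathbb{S}^1)$ denotes the index-2 subgroup of orientation-preserving homeomorphisms. The action of $G$ on $\mathbb{S}^1$ is minimal if every orbit is dense; it is proximal if for all open intervals $I, J \subsetneq \mathbb{S}^1$ with $J \neq \emptyset$ there exists $g \in G$ with $g(I) \subset J$; it is topologically free if the set of fixed points of every non-trivial $g \in G$ has empty interior. An action on $\Omega$ is $k$-transitive if $G$ acts transitively on ordered $k$-tuples of distinct elements of $\Omega$. Two actions of $G$ on sets $\Omega, \Omega'$ are conjugate if there is a $G$-equivariant bijection $\Omega \to \Omega'$. *)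

(* Defs.v *)
From Stdlib Require Import Reals.
Open Scope R_scope.

Record S1 : Type := MkS1 { angle : R; angle_range : 0 <= angle < 1 }.

(* Arc-length (geodesic) distance on S^1 (total length 1); it induces the
   standard topology of the circle. *)
Definition cdist (x y : S1) : R :=
  Rmin (Rabs (angle x - angle y)) (1 - Rabs (angle x - angle y)).

Definition ccw_disp (a z : S1) : R := frac_part (angle z - angle a).

(* z lies in the open arc going counterclockwise from a to b.
   For a <> b these are the proper open arcs (a,b) of S^1. *)
Definition in_arc (a b z : S1) : Prop := 0 < ccw_disp a z < ccw_disp a b.

Definition cyc (a b c : S1) : Prop := in_arc a c b.

Definition continuous_S1 (f : S1 -> S1) : Prop :=
  forall x eps, 0 < eps -> exists delta, 0 < delta /\
    forall y, cdist x y < delta -> cdist (f x) (f y) < eps.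

Definition is_homeo (f : S1 -> S1) : Prop :=
  continuous_S1 f /\ exists h : S1 -> S1, continuous_S1 h /\
    (forall x, h (f x) = x) /\ (forall x, f (h x) = x).

Definition orient_pres (f : S1 -> S1) : Prop :=
  forall a b c, cyc a b c -> cyc (f a) (f b) (f c).

Definition homeo_subgroup (G : (S1 -> S1) -> Prop) : Prop :=
  (forall g, G g -> is_homeo g) /\
  G (fun x => x) /\
  (forall g h, G g -> G h -> G (fun x => g (h x))) /\
  (forall g, G g -> exists h, G h /\ (forall x, h (g x) = x) /\ (forall x, g (h x) = x)).

Definition minimal_action (G : (S1 -> S1) -> Prop) : Prop :=
  forall x y eps, 0 < eps -> exists g, G g /\ cdist (g x) y < eps.

Definition proximal_action (G : (S1 -> S1) -> Prop) : Prop :=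
  forall a b c d : S1, a <> b -> c <> d ->
    exists g, G g /\ forall z, in_arc a b z -> in_arc c d (g z).

Definition top_free (G : (S1 -> S1) -> Prop) : Prop :=
  forall g, G g -> ~ (forall x, g x = x) ->
    ~ (exists x eps, 0 < eps /\ forall y, cdist x y < eps -> g y = y).

Definition stab_plus_injective (G : (S1 -> S1) -> Prop) : Prop :=
  forall z w : S1,
    (forall g, G g -> orient_pres g -> (g z = z <-> g w = w)) -> z = w.

Definition is_action (G : (S1 -> S1) -> Prop) (Omega : Type)
  (act : (S1 -> S1) -> Omega -> Omega) : Prop :=
  (forall w, act (fun x => x) w = w) /\
  (forall g h w, G g -> G h -> act (fun x => g (h x)) w = act g (act h w)).

Definition faithful_action (G : (S1 -> S1) -> Prop) (Omega : Type)
  (act : (S1 -> S1) -> Omega -> Omega) : Prop :=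
  forall g, G g -> (forall w, act g w = w) -> forall x, g x = x.

Definition three_transitive (G : (S1 -> S1) -> Prop) (Omega : Type)
  (act : (S1 -> S1) -> Omega -> Omega) : Prop :=
  forall x1 x2 x3 y1 y2 y3 : Omega,
    x1 <> x2 -> x1 <> x3 -> x2 <> x3 ->
    y1 <> y2 -> y1 <> y3 -> y2 <> y3 ->
    exists g, G g /\ act g x1 = y1 /\ act g x2 = y2 /\ act g x3 = y3.

Definition conj_to_orbit (G : (S1 -> S1) -> Prop) (Omega : Type)
  (act : (S1 -> S1) -> Omega -> Omega) (z : S1) : Prop :=
  exists phi : Omega -> S1,
    (forall w, exists g, G g /\ phi w = g z) /\
    (forall g, G g -> exists w, phi w = g z) /\
    (forall w1 w2, phi w1 = phi w2 -> w1 = w2) /\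
    (forall g w, G g -> phi (act g w) = g (phi w)).

(* Main.v *)
Require Import Defs.
From Stdlib Require Import Reals.
From Stdlib Require Import Lra Classical ClassicalEpsilon FunctionalExtensionality ProofIrrelevance Ranalysis5.
Open Scope R_scope.

(** For an arc [K] let [R_K] be the group of the elements of [G] supported in [K]; as [G] is proximal and not
    topologically free, every [R_K] is non-abelian, and [R_K], [R_L] commute when [K] and [L] are disjoint.
    Write [H] for the stabilizer of a point [w] of [Omega].

    Suppose first that [a w], [b w] and [w] are distinct for some [a] in [R_I], [b] in [R_J], [I] and [J] disjoint.
    By 3-transitivity every triple of [Omega] is of this form.  Hence the elements that are the identity near a given
    point of the circle already act transitively on [Omega], so [H] contains every germ of [G].  This makes [H] minimal
    and yields arcs that [H] contracts into any open set.  If some arc is not contractible by [H], each [x] has a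
    furthest point [y] that contractible arcs [(x, t)] reach; this relation is changed only by elements moving [x]
    or [y], and comparing it at the triples [w, a w, b w] and [w, a w, a (a w)] gives a contradiction.  If all arcs are
    contractible, then the commutators of every [R_K] fix [w], hence all of [Omega], contradicting faithfulness.

    Otherwise, if [I] and [J] are disjoint then [R_I] or [R_J] fixes [w].  Let [core w] be the set of the common fixed
    points of the groups [R_U] such that some [R_L] with [L] disjoint from [U] moves [w].  These closed sets are
    nonempty and pairwise disjoint, and 3-transitivity prevents them from separating one another, so each is a
    singleton; this is the equivariant injection of [Omega] into the circle. *)

(** * Arcs of the circle *)

Lemma S1_eq (x y : S1) : angle x = angle y -> x = y.
Proof.
  destruct x as [a Ha], y as [b Hb]; simpl; intros <-; f_equal; apply proof_irrelevance.
Qed.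

Lemma frac_part_unique (r : R) (z : Z) : 0 <= r - IZR z < 1 -> frac_part r = r - IZR z.
Proof.
  intros H; unfold frac_part; rewrite <- (Int_part_spec r z); [reflexivity | lra].
Qed.

Lemma ccw_disp_cases (a z : S1) :
  (angle a <= angle z /\ ccw_disp a z = angle z - angle a) \/
  (angle z < angle a /\ ccw_disp a z = angle z - angle a + 1).
Proof.
  unfold ccw_disp; pose proof (angle_range a); pose proof (angle_range z).
  destruct (Rle_lt_dec (angle a) (angle z)); [left | right]; split; auto.
  - rewrite (frac_part_unique _ 0); lra.
  - rewrite (frac_part_unique _ (-1)); lra.
Qed.

Lemma ccw_disp_range (a z : S1) : 0 <= ccw_disp a z < 1.
Proof.
  pose proof (angle_range a); pose proof (angle_range z).
  destruct (ccw_disp_cases a z) as [[? ->]|[? ->]]; lra.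
Qed.

Lemma ccw_disp_inj (a y z : S1) : ccw_disp a y = ccw_disp a z -> y = z.
Proof.
  pose proof (angle_range y); pose proof (angle_range z); intro E; apply S1_eq.
  destruct (ccw_disp_cases a y) as [[? Hy]|[? Hy]], (ccw_disp_cases a z) as [[? Hz]|[? Hz]]; lra.
Qed.

Lemma ccw_disp_self (a : S1) : ccw_disp a a = 0.
Proof. destruct (ccw_disp_cases a a) as [[? Hy]|[? Hy]]; lra. Qed.

Lemma ccw_disp_pos (a z : S1) : z <> a -> 0 < ccw_disp a z.
Proof.
  intro N; destruct (ccw_disp_range a z) as [[?|E] _]; auto.
  exfalso; apply N, (ccw_disp_inj a); rewrite ccw_disp_self; auto.
Qed.

Lemma ccw_disp_surj (a : S1) (d : R) : 0 <= d < 1 -> exists z, ccw_disp a z = d.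
Proof.
  intro Hd; pose proof (angle_range a).
  destruct (Rlt_le_dec (angle a + d) 1).
  - assert (Hr : 0 <= angle a + d < 1) by lra; exists (MkS1 _ Hr).
    destruct (ccw_disp_cases a (MkS1 _ Hr)) as [[? Hy]|[? Hy]]; simpl in *; lra.
  - assert (Hr : 0 <= angle a + d - 1 < 1) by lra; exists (MkS1 _ Hr).
    destruct (ccw_disp_cases a (MkS1 _ Hr)) as [[? Hy]|[? Hy]]; simpl in *; lra.
Qed.

Lemma in_arc_angle (a b z : S1) : in_arc a b z <->
  angle a < angle z < angle b \/ angle z < angle b < angle a \/ angle b < angle a < angle z.
Proof.
  unfold in_arc; pose proof (angle_range a); pose proof (angle_range b); pose proof (angle_range z).
  destruct (ccw_disp_cases a b) as [[? ->]|[? ->]], (ccw_disp_cases a z) as [[? ->]|[? ->]]; lra.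
Qed.

Lemma not_in_arc_angle (a b z : S1) : ~ in_arc a b z <->
  angle a = angle z \/ angle z = angle b \/ angle a = angle b \/
  angle b < angle z < angle a \/ angle z < angle a < angle b \/ angle a < angle b < angle z.
Proof. rewrite in_arc_angle; lra. Qed.

Lemma neq_angle (a b : S1) : a <> b <-> angle a < angle b \/ angle b < angle a.
Proof.
  split.
  - intro N; destruct (Rtotal_order (angle a) (angle b)) as [?|[E|?]]; auto.
    exfalso; apply N, S1_eq, E.
  - intros H ->; lra.
Qed.

Ltac splits := repeat lazymatch goal with |- _ /\ _ => split end.

(** Cyclic order is decided by cutting the circle at angle 0: each hypothesis on arcs becomes a
    disjunction of linear orderings of angles, and [circ] refutes every branch by linear
    arithmetic. *)
Ltac circ_hyps := repeat match goal with
  | H : ~ (_ \/ _) |- _ => apply not_or_and in H; destruct H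
  | H : ~ ~ _ |- _ => apply NNPP in H
  | H : in_arc _ _ _ /\ _ |- _ => destruct H
  | H : in_arc _ _ _ \/ _ |- _ => destruct H
  | H : in_arc _ _ _ |- _ => apply in_arc_angle in H
  | H : ~ in_arc _ _ _ |- _ => apply not_in_arc_angle in H
  | H : ?a <> ?b |- _ => match type of a with S1 => apply neq_angle in H end
  | H : ~ (@eq S1 _ _) |- _ => apply neq_angle in H
  | H : @eq S1 _ _ |- _ => apply (f_equal angle) in H
  end.
Ltac circ_branch := first [ lra | lazymatch goal with
  | H : _ /\ _ \/ _ |- _ => destruct H as [H|H]; circ_branch
  | H : _ \/ _ |- _ => destruct H as [H|H]; circ_branch end ].
Ltac circ := intros; splits; intros; splits; subst;
  match goal with
  | |- False => idtac
  | |- ~ _ => intro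
  | |- _ => apply NNPP; intro
  end;
  circ_hyps; circ_branch.

Lemma in_arc_ex (a b : S1) : a <> b -> exists z, in_arc a b z.
Proof.
  intro N; pose proof (ccw_disp_pos a b (not_eq_sym N)); pose proof (ccw_disp_range a b).
  destruct (ccw_disp_surj a (ccw_disp a b / 2)) as [z Hz]; [lra|].
  exists z; unfold in_arc; lra.
Qed.

(* The closed arc from [a] to [b] is the complement of the open arc from [b] to [a]. *)
Definition is_carc (K : S1 -> Prop) := exists a b, a <> b /\ forall z, K z <-> ~ in_arc b a z.
Definition is_oarc (D : S1 -> Prop) := exists a b, a <> b /\ forall z, D z <-> in_arc a b z.
Definition disjoint (A B : S1 -> Prop) := forall z, A z -> B z -> False.

(** An arc through [p] and [q] contains one of the two arcs that they bound, hence [r] or [s]. *)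
Lemma carc_unlinked (K : S1 -> Prop) (p q r s : S1) :
  is_carc K -> K p -> K q -> ~ K r -> ~ K s -> in_arc p q r -> in_arc q p s -> False.
Proof.
  intros (a & b & N & E) Hp Hq Hr Hs; apply E in Hp, Hq; rewrite E in Hr, Hs.
  apply NNPP in Hr, Hs; circ.
Qed.

Lemma carcs_unlinked (K L : S1 -> Prop) (p q r s : S1) :
  is_carc K -> disjoint K L -> K p -> K q -> L r -> L s -> in_arc p q r -> in_arc q p s -> False.
Proof.
  intros HK HD Hp Hq Hr Hs; apply (carc_unlinked K); auto; intro; eapply HD; eauto.
Qed.

Lemma in_arc_total (p q z : S1) : p <> q -> z <> p -> z <> q -> in_arc p q z \/ in_arc q p z.
Proof. circ. Qed.

Lemma in_arc_rot (a b z : S1) : in_arc a b z -> in_arc z a b.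
Proof. circ. Qed.

Lemma gap_cases (p q r v : S1) : in_arc p r q -> v <> p -> v <> q -> v <> r ->
  in_arc p q v \/ in_arc q r v \/ in_arc r p v.
Proof. circ. Qed.

Lemma gap_opposite (p q r v : S1) : in_arc p r q -> in_arc q r v -> in_arc p v q /\ in_arc v p r.
Proof. intros; split; circ. Qed.

(** Otherwise [U] and [V] each have a point in every [Kk], and these six points cannot be placed on
    the circle without a pair from one of the arcs separating two points outside it. *)
Lemma three_arcs (K1 K2 K3 U V : S1 -> Prop) :
  is_carc K1 -> is_carc K2 -> is_carc K3 -> is_carc U -> is_carc V ->
  disjoint K1 K2 -> disjoint K1 K3 -> disjoint K2 K3 -> disjoint U V ->
  (disjoint U K1 \/ disjoint V K1) \/ (disjoint U K2 \/ disjoint V K2) \/ (disjoint U K3 \/ disjoint V K3).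
Proof.
  intros C1 C2 C3 CU CV D12 D13 D23 DUV.
  assert (meet : forall A B, ~ disjoint A B -> exists z, A z /\ B z).
  { intros A B H; apply NNPP; intro N; apply H; intros z ? ?; apply N; eauto. }
  apply NNPP; intro N.
  destruct (meet U K1) as (u1 & ? & ?); [tauto|].
  destruct (meet U K2) as (u2 & ? & ?); [tauto|].
  destruct (meet U K3) as (u3 & ? & ?); [tauto|].
  destruct (meet V K1) as (v1 & ? & ?); [tauto|].
  destruct (meet V K2) as (v2 & ? & ?); [tauto|].
  destruct (meet V K3) as (v3 & ? & ?); [tauto|].
  clear N meet.
  assert (ne : forall A B p q, disjoint A B -> A p -> B q -> p <> q).
  { intros A B p q HD ? ? ->; eapply HD; eauto. }
  assert (u1 <> u2) by (eapply (ne K1 K2); eauto).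
  assert (u1 <> u3) by (eapply (ne K1 K3); eauto).
  assert (u2 <> u3) by (eapply (ne K2 K3); eauto).
  assert (n1 : ~ K1 u2 /\ ~ K1 u3) by (split; intro; [apply (D12 u2) | apply (D13 u3)]; auto).
  assert (n2 : ~ K2 u1 /\ ~ K2 u3) by (split; intro; [apply (D12 u1) | apply (D23 u3)]; auto).
  assert (n3 : ~ K3 u1 /\ ~ K3 u2) by (split; intro; [apply (D13 u1) | apply (D23 u2)]; auto).
  (* No v_k lies in the gap of {u1, u2, u3} opposite to u_k, yet all three lie in one gap. *)
  assert (vu : forall u v, U u -> V v -> v <> u) by (intros u v ? ? ->; eapply DUV; eauto).
  assert (v1 <> u1 /\ v1 <> u2 /\ v1 <> u3 /\ v2 <> u1 /\ v2 <> u2 /\ v2 <> u3 /\ v3 <> u1 /\ v3 <> u2 /\ v3 <> u3)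
    as (? & ? & ? & ? & ? & ? & ? & ? & ?) by (splits; apply vu; auto).
  assert (a1 : in_arc u1 v1 u2 -> in_arc v1 u1 u3 -> False)
    by (apply (carc_unlinked K1); tauto).
  assert (a1' : in_arc u1 v1 u3 -> in_arc v1 u1 u2 -> False)
    by (apply (carc_unlinked K1); tauto).
  assert (a2 : in_arc u2 v2 u1 -> in_arc v2 u2 u3 -> False)
    by (apply (carc_unlinked K2); tauto).
  assert (a2' : in_arc u2 v2 u3 -> in_arc v2 u2 u1 -> False)
    by (apply (carc_unlinked K2); tauto).
  assert (a3 : in_arc u3 v3 u1 -> in_arc v3 u3 u2 -> False)
    by (apply (carc_unlinked K3); tauto).
  assert (a3' : in_arc u3 v3 u2 -> in_arc v3 u3 u1 -> False)
    by (apply (carc_unlinked K3); tauto).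
  assert (b : forall u u' v v', U u -> U u' -> V v -> V v' -> in_arc u u' v -> in_arc u' u v' -> False).
  { intros u u' v v'; intros; apply (carcs_unlinked U V u u' v v'); auto. }
  assert (b1 : in_arc u1 u2 v1 -> in_arc u2 u1 v3 -> False) by (apply b; auto).
  assert (b2 : in_arc u2 u1 v1 -> in_arc u1 u2 v3 -> False) by (apply b; auto).
  assert (b3 : in_arc u1 u3 v1 -> in_arc u3 u1 v2 -> False) by (apply b; auto).
  assert (b4 : in_arc u3 u1 v1 -> in_arc u1 u3 v2 -> False) by (apply b; auto).
  pose proof in_arc_total as g.
  clear b vu ne n1 n2 n3.
  assert (C : in_arc u1 u3 u2 \/ in_arc u3 u1 u2) by auto.
  destruct C as [C|C].
  - destruct (gap_cases u1 u2 u3 v1) as [A|[A|A]]; auto.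
    + assert (in_arc u1 u2 v3) by (destruct (g u1 u2 v3); auto; exfalso; auto).
      apply a3; apply (gap_opposite u3 u1 u2 v3); auto using in_arc_rot.
    + apply a1; apply (gap_opposite u1 u2 u3 v1); auto.
    + assert (in_arc u3 u1 v2) by (destruct (g u3 u1 v2); auto; exfalso; auto).
      apply a2'; apply (gap_opposite u2 u3 u1 v2); auto using in_arc_rot.
  - assert (C' : in_arc u1 u2 u3) by auto using in_arc_rot.
    destruct (gap_cases u1 u3 u2 v1) as [A|[A|A]]; auto.
    + assert (in_arc u1 u3 v2) by (destruct (g u1 u3 v2); auto; exfalso; auto).
      apply a2; apply (gap_opposite u2 u1 u3 v2); auto using in_arc_rot.
    + apply a1'; apply (gap_opposite u1 u3 u2 v1); auto.
    + assert (in_arc u2 u1 v3) by (destruct (g u2 u1 v3); auto; exfalso; auto).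
      apply a3'; apply (gap_opposite u3 u2 u1 v3); auto using in_arc_rot.
Qed.

Lemma carc_compl (K : S1 -> Prop) : is_carc K -> is_oarc (fun z => ~ K z).
Proof.
  intros (a & b & N & E); exists b, a; split; auto; intro z; rewrite E; split; [apply NNPP | auto].
Qed.

Lemma oarc_compl (D : S1 -> Prop) : is_oarc D -> is_carc (fun z => ~ D z).
Proof.
  intros (a & b & N & E); exists b, a; split; auto; intro z; rewrite E; tauto.
Qed.

Lemma oarc_ex (D : S1 -> Prop) : is_oarc D -> exists z, D z.
Proof.
  intros (a & b & N & E); destruct (in_arc_ex a b N) as [z Hz]; exists z; apply E, Hz.
Qed.

Lemma arc_inside (a b x s t : S1) : in_arc a b x -> in_arc a x s -> in_arc x b t ->
  s <> t /\ in_arc s t x /\ forall z, in_arc s t z -> in_arc a b z.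
Proof. circ. Qed.

Lemma oarc_inter (D1 D2 : S1 -> Prop) x : is_oarc D1 -> is_oarc D2 -> D1 x -> D2 x ->
  exists D, is_oarc D /\ D x /\ forall z, D z -> D1 z /\ D2 z.
Proof.
  intros (a & b & N & E) (c & d & N' & E') H1 H2; apply E in H1; apply E' in H2.
  (* The intersection can be disconnected, so only a piece around [x] is kept: [l] is the nearer
     left endpoint, [r] the nearer right one. *)
  assert (L : exists l, l <> x /\ (forall z, in_arc l x z -> in_arc a x z /\ in_arc c x z) /\ (l = a \/ l = c)).
  { destruct (classic (in_arc a x c)); [exists c | exists a]; splits; auto; circ. }
  assert (R : exists r, r <> x /\ (forall z, in_arc x r z -> in_arc x b z /\ in_arc x d z) /\ (r = b \/ r = d)).
  { destruct (classic (in_arc x b d)); [exists d | exists b]; splits; auto; circ. }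
  destruct L as (l & Hl & Ll & _), R as (r & Hr & Rr & _).
  destruct (in_arc_ex l x) as [s Hs]; auto. destruct (in_arc_ex x r) as [t Ht]; auto.
  destruct (Ll s Hs), (Rr t Ht).
  destruct (arc_inside a b x s t) as (Nst & Hx & I1); auto.
  destruct (arc_inside c d x s t) as (_ & _ & I2); auto.
  exists (in_arc s t); split; [exists s, t; tauto | split; [auto|]].
  intros z Hz; rewrite E, E'; auto.
Qed.

Lemma oarc_separate (x y : S1) : x <> y ->
  exists D1 D2, is_oarc D1 /\ is_oarc D2 /\ D1 x /\ D2 y /\ disjoint D1 D2.
Proof.
  intro N; destruct (in_arc_ex x y N) as [s Hs]; destruct (in_arc_ex y x) as [t Ht]; auto.
  exists (in_arc t s), (in_arc s t); splits; try (exists t, s; split; [circ | tauto]);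
    try (exists s, t; split; [circ | tauto]); try solve [circ]; intros z; circ.
Qed.

Lemma oarc_two (D : S1 -> Prop) : is_oarc D ->
  exists K1 K2, is_carc K1 /\ is_carc K2 /\ disjoint K1 K2 /\
    (forall z, K1 z -> D z) /\ (forall z, K2 z -> D z).
Proof.
  intros (a & b & N & E); destruct (in_arc_ex a b N) as [s1 H1].
  destruct (in_arc_ex s1 b) as [s2 H2]; [circ|]. destruct (in_arc_ex s2 b) as [s3 H3]; [circ|].
  destruct (in_arc_ex s3 b) as [s4 H4]; [circ|].
  exists (fun z => ~ in_arc s2 s1 z), (fun z => ~ in_arc s4 s3 z).
  split; [exists s1, s2; split; [circ | tauto]|]. split; [exists s3, s4; split; [circ | tauto]|].
  split; [intro z; circ|]. split; intro z; rewrite E; circ.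
Qed.

Lemma oarc_carc (D : S1 -> Prop) : is_oarc D -> exists K, is_carc K /\ forall z, K z -> D z.
Proof. intro H; destruct (oarc_two D H) as (K & _ & ? & _ & _ & ? & _); eauto. Qed.

Lemma carc_oarc (K : S1 -> Prop) : is_carc K -> exists D, is_oarc D /\ forall z, D z -> K z.
Proof.
  intros (a & b & N & E); exists (in_arc a b); split; [exists a, b; tauto|].
  intro z; rewrite E; circ.
Qed.

Lemma carc_grow (K : S1 -> Prop) : is_carc K -> exists D, is_oarc D /\ forall z, K z -> D z.
Proof.
  intros (a & b & N & E). destruct (in_arc_ex b a) as [s Hs]; auto.
  destruct (in_arc_ex s a) as [t Ht]; [circ|].
  exists (in_arc t s); split; [exists t, s; split; [circ | tauto]|].
  intro z; rewrite E; circ.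
Qed.

Lemma carc_through (x y : S1) : exists K, is_carc K /\ K x /\ K y.
Proof.
  assert (P : exists p, p <> x /\ p <> y).
  { destruct (classic (x = y)) as [->|N].
    - destruct (ccw_disp_surj y (1/2)) as [p Hp]; [lra|].
      assert (p <> y) by (intros ->; rewrite ccw_disp_self in Hp; lra); eauto.
    - destruct (in_arc_ex x y N) as [p Hp]; exists p; split; circ. }
  destruct P as (p & Hx & Hy).
  destruct (oarc_separate x p) as (D1 & D2 & _ & ? & ? & ? & Dj); auto.
  destruct (oarc_separate y p) as (E1 & E2 & _ & ? & ? & ? & Ej); auto.
  destruct (oarc_inter D2 E2 p) as (F & ? & ? & HF); auto.
  exists (fun z => ~ F z); split; [apply oarc_compl; auto|].
  split; intro HH; apply HF in HH as [? ?]; [apply (Dj x) | apply (Ej y)]; auto.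
Qed.

(* The left disjunct is the case [y = x]. *)
Lemma arc_cut (x : S1) (P : S1 -> Prop) :
  (forall s t, in_arc x t s -> P t -> P s) -> (exists v, v <> x /\ ~ P v) ->
  (forall t, t <> x -> ~ P t) \/
  exists y, y <> x /\ (forall t, in_arc x y t -> P t) /\ (forall t, in_arc y x t -> ~ P t).
Proof.
  intros Hd (v & Nv & Hv).
  set (E := fun d => exists t, t <> x /\ P t /\ ccw_disp x t = d).
  destruct (classic (exists d, E d)) as [HE|HE].
  2: { left; intros t Ht HP; apply HE; exists (ccw_disp x t), t; auto. }
  right.
  assert (UB : forall d, E d -> d <= ccw_disp x v).
  { intros d (t & Nt & Pt & <-); destruct (Rle_lt_dec (ccw_disp x t) (ccw_disp x v)); auto.
    exfalso; apply Hv, (Hd _ t); auto; split; [apply ccw_disp_pos|]; auto. }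
  destruct (completeness E) as [l [Hl1 Hl2]]; auto.
  { exists (ccw_disp x v); exact UB. }
  assert (Hl : 0 < l <= ccw_disp x v).
  { split; [|apply Hl2; exact UB]. destruct HE as [d Ed].
    apply Rlt_le_trans with d; [|apply Hl1; auto].
    destruct Ed as (t & Nt & _ & <-); apply ccw_disp_pos; auto. }
  pose proof (ccw_disp_range x v).
  destruct (ccw_disp_surj x l) as [y Hy]; [lra|].
  assert (Ny : y <> x) by (intros ->; rewrite ccw_disp_self in Hy; lra).
  exists y; split; [auto | split].
  - intros t [Ht1 Ht2]; apply NNPP; intro NP.
    assert (l <= ccw_disp x t); [|lra].
    apply Hl2; intros d (s & Ns & Ps & <-).
    destruct (Rle_lt_dec (ccw_disp x s) (ccw_disp x t)); auto.
    exfalso; apply NP, (Hd _ s); auto; split; auto.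
  - intros t Ht Pt.
    assert (N : t <> x) by circ.
    assert (Ht' : in_arc x t y) by circ.
    assert (ccw_disp x t <= l) by (apply Hl1; exists t; auto).
    destruct Ht'; lra.
Qed.

Lemma oarc_near_left (D : S1 -> Prop) (t y : S1) : is_oarc D -> D y -> t <> y ->
  exists s, in_arc t y s /\ forall w, in_arc s y w -> D w.
Proof.
  intros (a & b & N & E) Hy Nt; apply E in Hy.
  destruct (classic (in_arc t y a)) as [H|H].
  - exists a; split; auto; intro w; rewrite E; circ.
  - destruct (in_arc_ex t y Nt) as [s Hs]; exists s; split; auto; intro w; rewrite E; circ.
Qed.

Lemma oarc_near_right (D : S1 -> Prop) (y t : S1) : is_oarc D -> D y -> t <> y ->
  exists s, in_arc y t s /\ forall w, in_arc y s w \/ w = s -> D w.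
Proof.
  intros (a & b & N & E) Hy Nt; apply E in Hy.
  assert (H : exists b', b' <> y /\ forall s, in_arc y b' s -> in_arc y t s /\ in_arc y b s).
  { destruct (classic (in_arc y t b)); [exists b | exists t]; circ. }
  destruct H as (b' & Nb & Hb); destruct (in_arc_ex y b') as [s Hs]; auto.
  destruct (Hb s Hs) as [H1 H2]; exists s; split; auto; clear Hb Hs H1 Nt.
  intros w [Hw| ->]; apply E; circ.
Qed.

Lemma arc_one_side (s t x y : S1) : x <> y -> ~ in_arc s t x -> ~ in_arc s t y ->
  (forall z, in_arc s t z -> in_arc x y z) \/ (forall z, in_arc s t z -> in_arc y x z).
Proof.
  intros N Hx Hy; apply NNPP; intro H; apply not_or_and in H as [H1 H2].
  apply not_all_ex_not in H1 as [z Hz], H2 as [z' Hz'].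
  apply imply_to_and in Hz as [Hz Mz], Hz' as [Hz' Mz'].
  assert (in_arc y x z) by (destruct (in_arc_total x y z); auto; try contradiction; intros ->; auto).
  assert (in_arc x y z') by (destruct (in_arc_total x y z'); auto; try contradiction; intros ->; auto).
  clear N Mz Mz'; circ.
Qed.

(** * Homeomorphisms preserve or reverse the cyclic order *)

Lemma cdist_disp (p y z : S1) :
  cdist y z = Rmin (Rabs (ccw_disp p y - ccw_disp p z)) (1 - Rabs (ccw_disp p y - ccw_disp p z)).
Proof.
  unfold cdist; pose proof (angle_range y); pose proof (angle_range z); pose proof (angle_range p).
  destruct (ccw_disp_cases p y) as [[? ->]|[? ->]], (ccw_disp_cases p z) as [[? ->]|[? ->]];
    unfold Rmin, Rabs; repeat destruct Rcase_abs; repeat destruct Rle_dec; lra.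
Qed.

Lemma cdist_le (p y z : S1) : cdist y z <= Rabs (ccw_disp p y - ccw_disp p z).
Proof. rewrite (cdist_disp p); apply Rmin_l. Qed.

Lemma ccw_disp_continuous (p y : S1) (eps : R) : y <> p -> 0 < eps ->
  exists delta, 0 < delta /\ forall z, cdist y z < delta -> Rabs (ccw_disp p z - ccw_disp p y) < eps.
Proof.
  intros N He; pose proof (ccw_disp_pos p y N); pose proof (ccw_disp_range p y).
  exists (Rmin eps (Rmin (ccw_disp p y) (1 - ccw_disp p y))); split.
  - repeat apply Rmin_glb_lt; lra.
  - intros z Hz; rewrite (cdist_disp p) in Hz; pose proof (ccw_disp_range p z).
    unfold Rmin, Rabs in *; repeat destruct Rcase_abs; repeat destruct Rle_dec; lra.
Qed.

Lemma ball_oarc (x : S1) (eps : R) : 0 < eps ->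
  exists D, is_oarc D /\ D x /\ forall y, D y -> cdist x y < eps.
Proof.
  (* The cap 1/4 keeps the arc of length [2 * d] centred at [x] proper. *)
  intro He; set (d := Rmin (eps / 2) (1 / 4)).
  assert (Hd : 0 < d <= 1 / 4 /\ d < eps).
  { unfold d, Rmin; destruct Rle_dec; lra. }
  destruct (ccw_disp_surj x (1 - d)) as [a Ha]; [lra|].
  destruct (ccw_disp_surj a (2 * d)) as [b Hb]; [lra|].
  pose proof (angle_range a); pose proof (angle_range b); pose proof (angle_range x).
  assert (Hx : ccw_disp a x = d).
  { destruct (ccw_disp_cases x a) as [[? ?]|[? ?]], (ccw_disp_cases a x) as [[? ?]|[? ?]]; lra. }
  exists (in_arc a b); split; [|split].
  - exists a, b; split; [|tauto]; intros ->; rewrite ccw_disp_self in Hb; lra.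
  - split; lra.
  - intros y [Hy1 Hy2]; apply Rle_lt_trans with (1 := cdist_le a x y).
    rewrite Hx; apply Rabs_def1; lra.
Qed.

Section RealMonotone.
Variable F : R -> R.
Hypothesis F_cont : forall t, 0 < t < 1 -> continuity_pt F t.
Hypothesis F_inj : forall s t, 0 < s < 1 -> 0 < t < 1 -> F s = F t -> s = t.

Lemma ivt_value (a b v : R) : 0 < a -> a < b -> b < 1 ->
  F a < v < F b \/ F b < v < F a -> exists t, a <= t <= b /\ F t = v.
Proof.
  intros H1 H2 H3 [Hv|Hv].
  - destruct (IVT_interv (fun t => F t - v) a b) as [t [Ht E]]; try lra.
    + intros t Ht; apply continuity_pt_minus; [apply F_cont; lra | apply continuity_pt_const; intros ? ?; auto].
    + exists t; split; auto; lra.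
  - destruct (IVT_interv (fun t => v - F t) a b) as [t [Ht E]]; try lra.
    + intros t Ht; apply continuity_pt_minus; [apply continuity_pt_const; intros ? ?; auto | apply F_cont; lra].
    + exists t; split; auto; lra.
Qed.

(** Otherwise the value [v] is taken both before and after [b], against injectivity. *)
Lemma no_turn (a b c v : R) : 0 < a -> a < b -> b < c -> c < 1 ->
  (F a < v < F b /\ F c < v) \/ (F b < v < F a /\ v < F c) -> False.
Proof.
  intros H1 H2 H3 H4 Hv.
  destruct (ivt_value a b v) as (s & Hs & Es); try lra.
  destruct (ivt_value b c v) as (t & Ht & Et); try lra.
  assert (s = t) by (apply F_inj; lra). assert (E : s = b) by lra; rewrite E in Es; lra.
Qed.

Lemma between_values (a b c : R) : 0 < a -> a < b -> b < c -> c < 1 ->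
  F a < F b < F c \/ F c < F b < F a.
Proof.
  intros H1 H2 H3 H4.
  assert (F a <> F b) by (intro E; apply F_inj in E; lra).
  assert (F b <> F c) by (intro E; apply F_inj in E; lra).
  pose proof (no_turn a b c ((F a + F b) / 2) H1 H2 H3 H4).
  pose proof (no_turn a b c ((F c + F b) / 2) H1 H2 H3 H4).
  destruct (Rtotal_order (F a) (F b)) as [L|[L|L]]; [|lra|];
  destruct (Rtotal_order (F b) (F c)) as [M|[M|M]]; try lra;
  destruct (Rle_lt_dec (F a) (F c)); lra.
Qed.

(** By [between_values], any two pairs have the direction of the endpoints of a larger interval
    containing both. *)
Lemma strictly_monotone :
  (forall s t, 0 < s -> s < t -> t < 1 -> F s < F t) \/ (forall s t, 0 < s -> s < t -> t < 1 -> F t < F s).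
Proof.
  assert (K : forall s t s' t', 0 < s -> s < t -> t < 1 -> 0 < s' -> s' < t' -> t' < 1 -> F s < F t -> F s' < F t').
  { intros s t s' t' H1 H2 H3 H1' H2' H3' L.
    set (a := Rmin s s' / 2); set (c := (Rmax t t' + 1) / 2).
    assert (0 < a /\ a < s /\ a < s') by (unfold a, Rmin; destruct Rle_dec; lra).
    assert (c < 1 /\ t < c /\ t' < c) by (unfold c, Rmax; destruct Rle_dec; lra).
    destruct (between_values a s t), (between_values a s c), (between_values a s' t'), (between_values a s' c); lra. }
  destruct (Rlt_le_dec (F (1/3)) (F (2/3))) as [L|L].
  - left; intros s t H1 H2 H3; apply (K (1/3) (2/3)); lra.
  - right; intros s t H1 H2 H3; apply Rnot_le_lt; intros [M|M].
    + assert (F (1/3) < F (2/3)) by (apply (K s t); lra); lra.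
    + apply F_inj in M; lra.
Qed.
End RealMonotone.

Lemma in_arc_disp (p a b z : S1) : in_arc a b z <->
  ccw_disp p a < ccw_disp p z < ccw_disp p b \/ ccw_disp p z < ccw_disp p b < ccw_disp p a \/
  ccw_disp p b < ccw_disp p a < ccw_disp p z.
Proof.
  rewrite in_arc_angle; pose proof (angle_range a); pose proof (angle_range b); pose proof (angle_range z).
  destruct (ccw_disp_cases p a) as [[? ->]|[? ->]], (ccw_disp_cases p b) as [[? ->]|[? ->]],
   (ccw_disp_cases p z) as [[? ->]|[? ->]]; lra.
Qed.

Definition orient_rev (f : S1 -> S1) : Prop := forall a b z, in_arc a b z -> in_arc (f b) (f a) (f z).

Definition point (t : R) (H : 0 < t < 1) : S1 := MkS1 t (conj (Rlt_le _ _ (proj1 H)) (proj2 H)).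

(** Cutting the source at [o] and the target at [f o] turns [f] into a continuous injective real
    function on the open unit interval, which is monotone. *)
Lemma homeo_orient (f : S1 -> S1) : is_homeo f -> orient_pres f \/ orient_rev f.
Proof.
  intros [Hc (h & _ & Hl & _)].
  assert (Hinj : forall x y, f x = f y -> x = y) by (intros x y E; rewrite <- (Hl x), E; auto).
  assert (H01 : 0 <= 0 < 1) by lra.
  set (o := MkS1 0 H01); set (p := f o).
  (* The value 0 outside the open unit interval is a mere default. *)
  set (F := fun t => match Rlt_dec 0 t with left H0 => match Rlt_dec t 1 with
    | left H1 => ccw_disp p (f (point t (conj H0 H1))) | _ => 0 end | _ => 0 end).
  assert (FE : forall z, z <> o -> 0 < angle z /\ F (angle z) = ccw_disp p (f z)).
  { intros z Nz; pose proof (angle_range z).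
    assert (angle z <> 0) by (intro E; apply Nz, S1_eq; simpl; lra).
    unfold F; destruct Rlt_dec; [|lra]; destruct Rlt_dec; [|lra]; split; auto.
    do 2 f_equal; apply S1_eq; reflexivity. }
  assert (Fpt : forall t, 0 < t < 1 -> exists z, z <> o /\ angle z = t /\ F t = ccw_disp p (f z)).
  { intros t Ht; exists (point t Ht).
    assert (point t Ht <> o) by (intro E; apply (f_equal angle) in E; simpl in E; lra).
    splits; auto; apply (FE (point t Ht)); auto. }
  assert (Fc : forall t, 0 < t < 1 -> continuity_pt F t).
  { intros t Ht eps He; destruct (Fpt t Ht) as (z & Nz & Az & Ez).
    destruct (ccw_disp_continuous p (f z) eps) as (d1 & Hd1 & C1); auto.
    destruct (Hc z d1) as (d2 & Hd2 & C2); auto.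
    exists (Rmin d2 (Rmin t (1 - t))); split; [repeat apply Rmin_glb_lt; lra|].
    intros s [_ Hs]; simpl in *; unfold Rdist in *.
    assert (Hs' : 0 < s < 1 /\ Rabs (s - t) < d2).
    { unfold Rmin, Rabs in *; repeat destruct Rle_dec; repeat destruct Rcase_abs; lra. }
    destruct (Fpt s) as (y & Ny & Ay & Ey); [tauto|].
    rewrite Ey, Ez; apply C1, C2.
    apply Rle_lt_trans with (Rabs (angle z - angle y)); [apply Rmin_l|].
    rewrite Rabs_minus_sym, Ay, Az; tauto. }
  assert (Fi : forall s t, 0 < s < 1 -> 0 < t < 1 -> F s = F t -> s = t).
  { intros s t Hs Ht E; destruct (Fpt s Hs) as (y & ? & <- & Ey), (Fpt t Ht) as (z & ? & <- & Ez).
    rewrite Ey, Ez in E; apply ccw_disp_inj, Hinj in E; subst; auto. }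
  assert (Go : ccw_disp p (f o) = 0) by apply ccw_disp_self.
  assert (Gp : forall z, z <> o -> 0 < ccw_disp p (f z)) by (intros; apply ccw_disp_pos; auto).
  assert (Ao : angle o = 0) by reflexivity.
  destruct (strictly_monotone F Fc Fi) as [M|M]; [left | right].
  - assert (M' : forall y z, angle y < angle z -> ccw_disp p (f y) < ccw_disp p (f z)).
    { intros y z L; pose proof (angle_range z); pose proof (angle_range y).
      assert (Nz : z <> o) by (intros ->; lra).
      destruct (classic (y = o)) as [->|Ny]; [rewrite Go; auto|].
      destruct (FE y Ny) as [? <-], (FE z Nz) as [? <-]; apply M; lra. }
    intros a b c H; apply (in_arc_disp p); apply in_arc_angle in H.
    destruct H as [[? ?]|[[? ?]|[? ?]]]; [left | right; left | right; right]; auto.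
  - assert (M' : forall y z, y <> o -> angle y < angle z -> ccw_disp p (f z) < ccw_disp p (f y)).
    { intros y z Ny L; pose proof (angle_range z); pose proof (angle_range y).
      assert (Nz : z <> o) by (intros ->; lra).
      destruct (FE y Ny) as [? <-], (FE z Nz) as [? <-]; apply M; lra. }
    assert (H0 : forall y, angle y < angle o -> False) by (intro y; pose proof (angle_range y); lra).
    (* The displacement 0 of [f o] stays least even when [F] decreases, so [x = o] gives another
       linear form of the same reversed cyclic order. *)
    assert (P : forall x y z, angle x < angle y -> angle y < angle z ->
       ccw_disp p (f z) < ccw_disp p (f y) /\ (ccw_disp p (f y) < ccw_disp p (f x) \/ ccw_disp p (f x) < ccw_disp p (f z))).
    { intros x y z Lx Ly.
      assert (Ny : y <> o) by (intros ->; eauto). assert (Nz : z <> o) by (intros ->; eauto).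
      split; auto. destruct (classic (x = o)) as [->|Nx]; [right; rewrite Go; auto | left; auto]. }
    intros a b z H; apply (in_arc_disp p); apply in_arc_angle in H.
    destruct H as [[H1 H2]|[[H1 H2]|[H1 H2]]]; destruct (P _ _ _ H1 H2) as [? [?|?]]; lra.
Qed.

(** * Groups of homeomorphisms and their rigid stabilizers *)

Definition comp (g h : S1 -> S1) : S1 -> S1 := fun x => g (h x).
(** Choice makes inversion a total operation on maps, so that no proof of membership in [G] has to
    be carried along. *)
Definition finv (g : S1 -> S1) : S1 -> S1 := fun y => epsilon (inhabits y) (fun x => g x = y).
Definition pre (g : S1 -> S1) (A : S1 -> Prop) : S1 -> Prop := fun z => A (g z).
Definition img (g : S1 -> S1) (A : S1 -> Prop) : S1 -> Prop := pre (finv g) A.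
Definition conj_by (g a : S1 -> S1) : S1 -> S1 := comp g (comp a (finv g)).

Lemma pres_arc (f : S1 -> S1) a b z : orient_pres f -> in_arc a b z -> in_arc (f a) (f b) (f z).
Proof. intros H; apply (H a z b). Qed.

Lemma pres_arc_iff f a b z : orient_pres f -> (in_arc a b z <-> in_arc (f a) (f b) (f z)).
Proof.
  intro H; split; [apply pres_arc; auto|]; intro I; apply NNPP; intro N.
  assert (J : in_arc b a z).
  { assert (a <> b) by (intros ->; circ). assert (z <> a) by (intros ->; circ).
    assert (z <> b) by (intros ->; circ). circ. }
  apply (pres_arc f) in J; auto; circ.
Qed.

Lemma rev_arc_iff f a b z : orient_rev f -> (in_arc a b z <-> in_arc (f b) (f a) (f z)).
Proof.
  intro H; split; [apply H|]; intro I; apply NNPP; intro N.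
  assert (J : in_arc b a z).
  { assert (a <> b) by (intros ->; circ). assert (z <> a) by (intros ->; circ).
    assert (z <> b) by (intros ->; circ). circ. }
  apply H in J; circ.
Qed.
Section Group.
Variable G : (S1 -> S1) -> Prop.
Hypothesis HG : homeo_subgroup G.

Lemma G_id : G (fun x => x).
Proof. destruct HG as (_ & H & _); exact H. Qed.

Lemma G_comp g h : G g -> G h -> G (comp g h).
Proof. destruct HG as (_ & _ & H & _); exact (H g h). Qed.

Lemma finv_spec g : G g -> G (finv g) /\ (forall x, finv g (g x) = x) /\ (forall x, g (finv g x) = x).
Proof.
  intro Hg; destruct HG as (_ & _ & _ & HI); destruct (HI g Hg) as (h & Hh & L & R).
  assert (E : finv g = h).
  { extensionality y; rewrite <- (L (finv g y)); f_equal; unfold finv; apply epsilon_spec; eauto. }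
  rewrite E; auto.
Qed.

Lemma G_inv g : G g -> G (finv g).
Proof. apply finv_spec. Qed.

Lemma finvl g x : G g -> finv g (g x) = x.
Proof. intro; apply finv_spec; auto. Qed.

Lemma finvr g x : G g -> g (finv g x) = x.
Proof. intro; apply finv_spec; auto. Qed.

Lemma G_inj g x y : G g -> g x = g y -> x = y.
Proof. intros Hg E; rewrite <- (finvl g x), E by auto; apply finvl; auto. Qed.

Lemma finv_finv g : G g -> finv (finv g) = g.
Proof. intro Hg; extensionality x; apply (G_inj (finv g)); auto using G_inv; rewrite finvr, finvl; auto using G_inv. Qed.

Lemma G_conj g a : G g -> G a -> G (conj_by g a).
Proof. intros; apply G_comp; auto; apply G_comp; auto using G_inv. Qed.

Lemma G_orient g : G g -> orient_pres g \/ orient_rev g.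
Proof. destruct HG as (H & _); intro; apply homeo_orient; auto. Qed.

Lemma pre_arc g a b : G g ->
  (forall z, in_arc a b (g z) <-> in_arc (finv g a) (finv g b) z) \/
  (forall z, in_arc a b (g z) <-> in_arc (finv g b) (finv g a) z).
Proof.
  intro Hg;
  destruct (G_orient g Hg) as [O|O]; [left|right]; intro z.
  - rewrite (pres_arc_iff g (finv g a) (finv g b) z O), !finvr by auto; tauto.
  - rewrite (rev_arc_iff g (finv g b) (finv g a) z O), !finvr by auto; tauto.
Qed.

Lemma pre_oarc g D : G g -> is_oarc D -> is_oarc (pre g D).
Proof.
  intros Hg (a & b & N & E); unfold pre.
  assert (finv g a <> finv g b) by (intro X; apply N, (G_inj (finv g)); auto using G_inv).
  destruct (pre_arc g a b Hg) as [P|P]; [exists (finv g a), (finv g b) | exists (finv g b), (finv g a)];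
    split; auto; intro z; rewrite E; apply P.
Qed.

Lemma pre_carc g K : G g -> is_carc K -> is_carc (pre g K).
Proof.
  intros Hg (a & b & N & E); unfold pre.
  assert (finv g a <> finv g b) by (intro X; apply N, (G_inj (finv g)); auto using G_inv).
  destruct (pre_arc g b a Hg) as [P|P]; [exists (finv g a), (finv g b) | exists (finv g b), (finv g a)];
    split; auto; intro z; rewrite E, P; tauto.
Qed.

Lemma img_carc g K : G g -> is_carc K -> is_carc (img g K).
Proof. intros; apply pre_carc; auto using G_inv. Qed.

Lemma img_oarc g K : G g -> is_oarc K -> is_oarc (img g K).
Proof. intros; apply pre_oarc; auto using G_inv. Qed.

Lemma img_disjoint g A B : disjoint A B -> disjoint (img g A) (img g B).
Proof. intros H z; apply H. Qed.

(** The rigid stabilizer of [A], written [R_K] in the overview. *)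
Definition Rs (A : S1 -> Prop) (g : S1 -> S1) := G g /\ forall z, ~ A z -> g z = z.

Lemma Rs_G A g : Rs A g -> G g.
Proof. intros [? _]; auto. Qed.

Lemma Rs_mono (A B : S1 -> Prop) g : (forall z, A z -> B z) -> Rs A g -> Rs B g.
Proof. intros H [? ?]; split; auto. Qed.

Lemma Rs_comp A g h : Rs A g -> Rs A h -> Rs A (comp g h).
Proof. intros [? F] [? F']; split; [apply G_comp; auto|]; intros; unfold comp; rewrite F', F; auto. Qed.

Lemma Rs_inv A g : Rs A g -> Rs A (finv g).
Proof.
  intros [Hg F]; split; [apply G_inv; auto|]; intros z Hz; apply (G_inj g); auto.
  rewrite finvr, F; auto.
Qed.

Lemma Rs_conj A g a : G g -> Rs A a -> Rs (img g A) (conj_by g a).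
Proof.
  intros Hg [Ha F]; split; [apply G_conj; auto|]; intros z Hz; unfold conj_by, comp.
  rewrite F, finvr; auto.
Qed.

Lemma Rs_moved A a x : Rs A a -> a x <> x -> A x.
Proof. intros [_ F] N; apply NNPP; intro; apply N, F; auto. Qed.

Lemma Rs_stable (A : S1 -> Prop) a x : Rs A a -> A x -> A (a x).
Proof.
  intros Ra Hx; apply NNPP; intro N; apply N; pose proof (Rs_inv _ _ Ra) as [_ F].
  rewrite <- (F _ N), finvl by apply (Rs_G _ _ Ra); auto.
Qed.

Lemma Rs_commute A B a b : disjoint A B -> Rs A a -> Rs B b -> comp a b = comp b a.
Proof.
  intros D Ra Rb; extensionality x; unfold comp.
  destruct (classic (A x)) as [Hx|Hx].
  - pose proof (Rs_stable _ _ _ Ra Hx) as Hax.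
    rewrite (proj2 Rb x (D x Hx)), (proj2 Rb (a x) (D _ Hax)); auto.
  - rewrite (proj2 Ra x Hx); apply (proj2 Ra); intro Hbx.
    destruct (classic (B x)) as [Hy|Hy]; [apply (D (b x) Hbx), (Rs_stable B b); auto|].
    rewrite (proj2 Rb x Hy) in Hbx; auto.
Qed.

(** A reversing map would reverse the cyclic order of three points of [D], all of which are
    fixed. *)
Lemma fixing_pres g D : G g -> is_oarc D -> (forall z, D z -> g z = z) -> orient_pres g.
Proof.
  intros Hg (a & b & N & E) F; destruct (G_orient g Hg) as [O|O]; auto; exfalso.
  destruct (in_arc_ex a b N) as [u Hu]; destruct (in_arc_ex a u) as [v Hv]; [circ|].
  destruct (in_arc_ex a v) as [w Hw]; [circ|].
  assert (H : in_arc w u v) by circ. pose proof (O _ _ _ H) as H'.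
  rewrite !F in H' by (apply E; circ); circ.
Qed.

Lemma Rs_pres K a : is_carc K -> Rs K a -> orient_pres a.
Proof. intros HK [Ha F]; eapply (fixing_pres a _ Ha (carc_compl K HK)); auto. Qed.

Lemma moved_oarc g m : G g -> g m <> m -> exists D, is_oarc D /\ D m /\ forall z, D z -> ~ D (g z).
Proof.
  intros Hg N; destruct (oarc_separate m (g m)) as (D1 & D2 & O1 & O2 & H1 & H2 & Dj); auto.
  destruct (oarc_inter D1 (pre g D2) m) as (D & OD & Hm & Hs); auto using pre_oarc.
  exists D; splits; auto; intros z Hz Hgz; apply (Dj (g z)); [apply (Hs (g z) Hgz) | apply (Hs z Hz)].
Qed.

Lemma pres_comp g h : orient_pres g -> orient_pres h -> orient_pres (comp g h).
Proof. intros Hg Hh a b c H; apply Hg, Hh, H. Qed.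

Lemma rev_rev g h : orient_rev g -> orient_rev h -> orient_pres (comp g h).
Proof. intros Hg Hh a b c H; apply Hg, Hh, H. Qed.

Lemma pres_inv g : G g -> orient_pres g -> orient_pres (finv g).
Proof.
  intros Hg O a b c H; unfold cyc in *; apply (pres_arc_iff g); auto.
  rewrite !finvr; auto.
Qed.

Hypothesis Hprox : proximal_action G.

Lemma proximal K D : is_carc K -> is_oarc D -> exists g, G g /\ forall z, K z -> D (g z).
Proof.
  intros HK (c & d & N & E); destruct (carc_grow K HK) as (B & (a & b & N' & E') & I).
  destruct (Hprox a b c d N' N) as (g & Hg & H); exists g; split; auto.
  intros z Hz; apply E, H, E', I, Hz.
Qed.

(** If [G] contains a reversing [k], some [g] sends an arc through both [x] and [k x] into [D]; then
    [g] or [comp g k] preserves orientation. *)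
Lemma minimal_pres x D : is_oarc D -> exists g, G g /\ orient_pres g /\ D (g x).
Proof.
  intro HD; destruct (classic (exists k, G k /\ ~ orient_pres k)) as [(k & Hk & Nk)|N].
  - destruct (carc_through x (k x)) as (K & HK & Kx & Kkx).
    destruct (proximal K D HK HD) as (g & Hg & H).
    destruct (G_orient g Hg) as [O|O]; [exists g; auto|].
    exists (comp g k); splits; [apply G_comp; auto| |apply H; auto].
    apply rev_rev; auto; destruct (G_orient k Hk); tauto.
  - destruct (carc_through x x) as (K & HK & Kx & _).
    destruct (proximal K D HK HD) as (g & Hg & H).
    exists g; splits; auto; apply NNPP; eauto.
Qed.

Hypothesis Htf : ~ top_free G.

(** An element that is the identity on an arc is supported in the complementary closed arc, which
    proximality allows to conjugate into [K]. *)
Lemma Rs_nontrivial K : is_carc K -> exists a x, Rs K a /\ a x <> x.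
Proof.
  intro HK.
  assert (W : exists g, G g /\ (exists x, g x <> x) /\
    exists x eps, 0 < eps /\ forall y, cdist x y < eps -> g y = y).
  { apply NNPP; intro N; apply Htf; intros g Hg Nt B; apply N; exists g; splits; auto.
    apply not_all_ex_not in Nt; auto. }
  destruct W as (g & Hg & (m & Hm) & x & eps & He & F).
  destruct (ball_oarc x eps He) as (D & HD & _ & I).
  destruct (carc_oarc K HK) as (D' & HD' & I').
  destruct (proximal (fun z => ~ D z) D') as (k & Hk & J); auto using oarc_compl.
  exists (conj_by k g), (k m); split.
  - apply (Rs_mono (img k (fun z => ~ D z))).
    + intros z Hz; apply I'; rewrite <- (finvr k z Hk); apply J, Hz.
    + apply Rs_conj; auto; split; auto; intros z Hz; apply F, I, NNPP, Hz.
  - unfold conj_by, comp; rewrite finvl by auto; intro E; apply Hm, (G_inj k); auto.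
Qed.

(** Take [a] moving a small arc [D] off itself and [b] supported in [D]. At a point [y] moved by
    [b], the point [a y] is fixed by [b], so commuting would give [b y = y]. *)
Lemma Rs_nonabelian K : is_carc K -> exists a b x, Rs K a /\ Rs K b /\ a (b x) <> b (a x).
Proof.
  intro HK; destruct (carc_oarc K HK) as (D0 & HD0 & I0).
  destruct (oarc_carc D0 HD0) as (K0 & HK0 & J0).
  destruct (Rs_nontrivial K0 HK0) as (a & m & Ra & Hm).
  destruct (moved_oarc a m) as (D1 & HD1 & Dm & Hd); auto; [apply (Rs_G _ _ Ra)|].
  destruct (oarc_inter D0 D1 m) as (D & HD & _ & I); auto.
  { apply J0, (Rs_moved _ _ _ Ra Hm). }
  destruct (oarc_carc D HD) as (L & HL & J).
  destruct (Rs_nontrivial L HL) as (b & y & Rb & Hy).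
  exists a, b, y; splits.
  - eapply Rs_mono; [|exact Ra]; auto.
  - eapply Rs_mono; [|exact Rb]; intros; apply I0, I; auto.
  - pose proof (Rs_moved _ _ _ Rb Hy) as Ly.
    rewrite (proj2 Rb (a y)).
    + intro E; apply Hy, (G_inj a); auto; apply (Rs_G _ _ Ra).
    + intro H; apply (Hd y); [apply I, J, Ly | apply I, J, H].
Qed.

(** * The action on [Omega] *)

Variables (Omega : Type) (act : (S1 -> S1) -> Omega -> Omega).
Hypothesis HA : is_action G Omega act.
Hypothesis HF : faithful_action G Omega act.
Hypothesis H3 : three_transitive G Omega act.

Lemma act_id w : act (fun x => x) w = w.
Proof. destruct HA as [H _]; apply H. Qed.

Lemma act_comp g h w : G g -> G h -> act (comp g h) w = act g (act h w).
Proof. destruct HA as [_ H]; exact (H g h w). Qed.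

Lemma act_invl g w : G g -> act (finv g) (act g w) = w.
Proof.
  intro Hg; rewrite <- act_comp by auto using G_inv.
  replace (comp (finv g) g) with (fun x : S1 => x); [apply act_id|].
  extensionality x; unfold comp; rewrite finvl; auto.
Qed.

Lemma act_invr g w : G g -> act g (act (finv g) w) = w.
Proof. intro Hg; rewrite <- (finv_finv g Hg) at 1; apply act_invl, G_inv, Hg. Qed.

Lemma act_inj g v w : G g -> act g v = act g w -> v = w.
Proof. intros Hg E; rewrite <- (act_invl g v), E by auto; apply act_invl; auto. Qed.

Lemma act_conj g a w : G g -> G a -> act (conj_by g a) (act g w) = act g (act a w).
Proof.
  intros Hg Ha; unfold conj_by; rewrite !act_comp, act_invl; auto using G_comp, G_inv.
Qed.

Lemma act_fix_inv g w : G g -> act g w = w -> act (finv g) w = w.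
Proof. intros Hg E; rewrite <- E at 1; apply act_invl; auto. Qed.

Lemma act_commute A B a b w : disjoint A B -> Rs A a -> Rs B b -> act a (act b w) = act b (act a w).
Proof.
  intros D Ra Rb; rewrite <- !act_comp by (eapply Rs_G; eauto).
  rewrite (Rs_commute A B a b); auto.
Qed.

Lemma faithful_eq g h : G g -> G h -> (forall w, act g w = act h w) -> forall x, g x = h x.
Proof.
  intros Hg Hh E x; pose proof (G_comp _ _ (G_inv _ Hh) Hg) as Hk.
  assert (F : comp (finv h) g x = x).
  { apply HF; auto; intro w; rewrite act_comp, E, act_invl; auto using G_inv. }
  rewrite <- F at 2; unfold comp; rewrite finvr; auto.
Qed.

Lemma commuting_absurd K : is_carc K ->
  (forall a b w, Rs K a -> Rs K b -> act a (act b w) = act b (act a w)) -> False.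
Proof.
  intros HK C; destruct (Rs_nonabelian K HK) as (a & b & x & Ra & Rb & N); apply N.
  pose proof (Rs_G _ _ Ra); pose proof (Rs_G _ _ Rb).
  apply (faithful_eq (comp a b) (comp b a)); auto using G_comp.
  intro w; rewrite !act_comp; auto.
Qed.

Lemma carc_ex : exists K, is_carc K.
Proof. assert (H : 0 <= 0 < 1) by lra; destruct (carc_through (MkS1 0 H) (MkS1 0 H)) as (K & ? & _); eauto. Qed.

(** All permutations of at most two points commute, which contradicts [commuting_absurd]. *)
Lemma third_point (p q : Omega) : exists r, r <> p /\ r <> q.
Proof.
  apply NNPP; intro N.
  assert (T : forall r, r = p \/ r = q).
  { intro r; apply NNPP; intro H; apply not_or_and in H; apply N; eauto. }
  destruct carc_ex as [K HK]; apply (commuting_absurd K HK).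
  intros a b w Ra Rb.
  assert (Ia : forall u v, act a u = act a v -> u = v) by (intros u v; apply act_inj, (Rs_G _ _ Ra)).
  assert (Ib : forall u v, act b u = act b v -> u = v) by (intros u v; apply act_inj, (Rs_G _ _ Rb)).
  destruct (classic (p = q)) as [<-|Npq].
  - assert (T' : forall r, r = p) by (intro r; destruct (T r); auto). rewrite (T' (act a _)); auto.
  - destruct (T (act a p)) as [E1|E1], (T (act a q)) as [E2|E2], (T (act b p)) as [E3|E3], (T (act b q)) as [E4|E4];
      try (exfalso; first [apply Npq, Ia; congruence | apply Npq, Ib; congruence]);
      destruct (T w) as [->| ->]; congruence.
Qed.

Lemma two_transitive p q p' q' : p <> q -> p' <> q' -> exists g, G g /\ act g p = p' /\ act g q = q'.
Proof.
  intros N N'; destruct (third_point p q) as (r & ? & ?), (third_point p' q') as (r' & ? & ?).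
  destruct (H3 p q r p' q' r') as (g & ? & ? & ? & _); eauto.
Qed.

Lemma transitive p q : exists g, G g /\ act g p = q.
Proof.
  destruct (third_point p p) as (r & ? & _), (third_point q q) as (r' & ? & _).
  destruct (two_transitive p r q r') as (g & ? & ? & _); eauto.
Qed.

Lemma commuting_at_absurd w :
  (forall K a b, is_carc K -> Rs K a -> Rs K b -> act a (act b w) = act b (act a w)) -> False.
Proof.
  intro C; destruct carc_ex as [K HK]; apply (commuting_absurd K HK).
  intros a b p Ra Rb; destruct (transitive p w) as (g & Hg & Ep).
  pose proof (Rs_G _ _ Ra); pose proof (Rs_G _ _ Rb).
  apply (act_inj g); auto.
  rewrite <- !(act_conj g) by auto; rewrite Ep.
  apply (C (img g K)); auto using img_carc, Rs_conj.
Qed.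

Definition stab w h := G h /\ act h w = w.

Lemma stab_inv w h : stab w h -> stab w (finv h).
Proof. intros [? ?]; split; auto using G_inv, act_fix_inv. Qed.

Lemma stab_comp w g h : stab w g -> stab w h -> stab w (comp g h).
Proof. intros [? E] [? E']; split; auto using G_comp; rewrite act_comp, E'; auto. Qed.

(** * Disjointly supported elements moving a point to different points *)

Definition separated_moves := exists w I J a b, is_carc I /\ is_carc J /\ disjoint I J /\
  Rs I a /\ Rs J b /\ act a w <> w /\ act b w <> w /\ act a w <> act b w.

Definition identity_near x n := G n /\ exists D, is_oarc D /\ D x /\ forall z, D z -> n z = z.

Section SeparatedMoves.
Hypothesis HS : separated_moves.

Lemma separated_triples p q r : p <> q -> p <> r -> q <> r ->
  exists U V a b, is_carc U /\ is_carc V /\ disjoint U V /\ Rs U a /\ Rs V b /\ act a p = q /\ act b p = r.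
Proof.
  intros Npq Npr Nqr; destruct HS as (w & I & J & a & b & HI & HJ & D & Ra & Rb & Na & Nb & Nab).
  destruct (H3 w (act a w) (act b w) p q r) as (g & Hg & E1 & E2 & E3); auto.
  pose proof (Rs_G _ _ Ra); pose proof (Rs_G _ _ Rb).
  exists (img g I), (img g J), (conj_by g a), (conj_by g b); splits;
    auto using img_carc, img_disjoint, Rs_conj.
  - rewrite <- E1, act_conj; auto.
  - rewrite <- E1, act_conj; auto.
Qed.

Lemma identity_near_comp x m n : identity_near x m -> identity_near x n -> identity_near x (comp m n).
Proof.
  intros (Hm & D & OD & Dx & F) (Hn & E & OE & Ex & F').
  destruct (oarc_inter D E x) as (B & OB & Bx & I); auto.
  split; [apply G_comp; auto|]; exists B; splits; auto.
  intros z Hz; unfold comp; rewrite F', F; auto; apply I; auto.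
Qed.

Lemma identity_near_inv x n : identity_near x n -> identity_near x (finv n).
Proof.
  intros (Hn & D & OD & Dx & F); split; [apply G_inv; auto|]; exists D; splits; auto.
  intros z Hz; rewrite <- (F z Hz) at 1; apply finvl; auto.
Qed.

Lemma identity_near_Rs x K a : is_carc K -> ~ K x -> Rs K a -> identity_near x a.
Proof. intros HK Nx [Ha F]; split; auto; exists (fun z => ~ K z); auto using carc_compl. Qed.

(** The point [x] is in at most one of two disjoint supports. *)
Lemma identity_near_one_of x p q r : p <> q -> p <> r -> q <> r ->
  exists n, identity_near x n /\ (act n p = q \/ act n p = r).
Proof.
  intros N1 N2 N3; destruct (separated_triples p q r) as (U & V & a & b & HU & HV & D & Ra & Rb & Ea & Eb); auto.
  destruct (classic (U x)) as [Ux|Ux].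
  - exists b; split; auto; apply (identity_near_Rs x V); auto; intro Vx; apply (D x); auto.
  - exists a; split; auto; apply (identity_near_Rs x U); auto.
Qed.

Lemma identity_near_transitive x p q : exists n, identity_near x n /\ act n p = q.
Proof.
  destruct (classic (p = q)) as [->|N].
  - exists (fun z => z); split; [|apply act_id]; split; [apply G_id|].
    destruct (ball_oarc x 1) as (D & OD & Dx & _); [lra|]; exists D; auto.
  - destruct (third_point p q) as (r & Nr & Nr').
    (* Either [p] and [q] are joined directly, or both can be sent to the common point [r]. *)
    destruct (identity_near_one_of x p q r) as (n & Hn & [E|E]); eauto.
    destruct (identity_near_one_of x q p r) as (m & Hm & [E'|E']); auto.
    + exists (finv m); split; [apply identity_near_inv; auto|].
      rewrite <- E'; apply act_invl, Hm.
    + exists (comp (finv m) n); split; [apply identity_near_comp; auto using identity_near_inv|].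
      rewrite act_comp, E, <- E' by (apply Hn || apply G_inv, Hm); apply act_invl, Hm.
Qed.

(** A factor that is the identity near [x] brings [g] into the stabilizer of [w] without changing
    its germ at [x]. *)
Lemma stab_local w g x : G g -> exists h D, stab w h /\ is_oarc D /\ D x /\ forall z, D z -> h z = g z.
Proof.
  intro Hg; destruct (identity_near_transitive x w (act (finv g) w)) as (n & (Hn & D & OD & Dx & F) & E).
  exists (comp g n), D; splits; auto.
  - split; [apply G_comp; auto|]; rewrite act_comp, E, act_invr; auto.
  - intros z Hz; unfold comp; rewrite F; auto.
Qed.

Lemma stab_minimal w x D : is_oarc D -> exists h, stab w h /\ orient_pres h /\ D (h x).
Proof.
  intro OD; destruct (minimal_pres x D OD) as (g & Hg & Og & Dg).
  destruct (stab_local w g x Hg) as (h & E & Sh & OE & Ex & F).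
  exists h; splits; auto; [|rewrite F; auto].
  (* [h] and [g] agree on an arc, so [comp (finv g) h] is the identity there. *)
  assert (O : orient_pres (comp (finv g) h)).
  { apply (fixing_pres _ E); auto; [apply G_comp; auto using G_inv; apply Sh|].
    intros z Hz; unfold comp; rewrite F, finvl; auto. }
  replace h with (comp g (comp (finv g) h)); [apply pres_comp; auto|].
  extensionality z; unfold comp; rewrite finvr; auto.
Qed.

(** * Sets contracted by the stabilizer of a point *)

Definition contractible w (A : S1 -> Prop) :=
  forall D, is_oarc D -> exists h, stab w h /\ forall z, A z -> D (h z).

Lemma contractible_mono w (A B : S1 -> Prop) : (forall z, A z -> B z) -> contractible w B -> contractible w A.
Proof. intros I C D OD; destruct (C D OD) as (h & Hh & F); eauto. Qed.

Lemma contractible_img w k A : G k -> contractible w A -> contractible (act k w) (img k A).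
Proof.
  intros Hk C D OD; destruct (C (pre k D)) as (h & [Hh E] & F); auto using pre_oarc.
  exists (conj_by k h); split.
  - split; [apply G_conj; auto|]; rewrite act_conj, E; auto.
  - intros z Hz; apply (F (finv k z)), Hz.
Qed.

Lemma contractible_img_stab w k A : stab w k -> contractible w A -> contractible w (img k A).
Proof. intros [Hk E] C; rewrite <- E; apply contractible_img; auto. Qed.

(* [y] is the first fixed point of some [c] after a moved point: iterating [c] or its inverse pushes [t] to [y]. *)
Lemma contractible_ex w : exists A, is_oarc A /\ contractible w A.
Proof.
  destruct carc_ex as [K HK]; destruct (Rs_nontrivial K HK) as (c & m & Rc & Hm).
  destruct (oarc_ex _ (carc_compl K HK)) as [q Hq].
  pose proof (Rs_G _ _ Rc) as Gc; pose proof (Rs_pres _ _ HK Rc) as Pc.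
  assert (Fq : c q = q) by (apply Rc; auto).
  (* [y] ends the longest arc after [m] all of whose points are moved; being moved is an open
     condition, so [y] is not [m] and is fixed. *)
  assert (Y : exists y, y <> m /\ c y = y /\ forall u, in_arc m y u -> c u <> u).
  { destruct (arc_cut m (fun s => forall u, in_arc m s u \/ u = s -> c u <> u)) as [N|(y & Ny & Y1 & Y2)].
    - intros s t Hts Pt u [Hu| ->]; apply Pt; left; auto; circ.
    - exists q; split; [intros ->; auto|]; intro H; apply (H q); auto.
    - exfalso; destruct (moved_oarc c m Gc Hm) as (D & OD & Dm & HD).
      assert (Nq : q <> m) by (intros ->; auto).
      destruct (oarc_near_right D m q OD Dm Nq) as (s & Hs & I).
      apply (N s); [circ|]; intros u Hu E; apply (HD u (I u Hu)); rewrite E; auto.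
    - exists y; splits; auto; [|intros u Hu; apply (Y1 u); auto].
      apply NNPP; intro My; destruct (moved_oarc c y Gc My) as (D & OD & Dy & HD).
      destruct (oarc_near_right D y m OD Dy) as (s & Hs & I); auto.
      apply (Y2 s Hs); intros u Hu E.
      destruct (classic (in_arc m y u)) as [L|L]; [apply (Y1 u L u); auto|].
      destruct (classic (u = y)) as [->|Nu]; [auto|].
      apply (HD u); [|rewrite E]; apply I; destruct Hu as [Hu| ->]; auto; left; circ. }
  destruct Y as (y & Ny & Fy & Mv).
  pose proof (G_inv _ Gc) as Gc'.
  destruct (stab_local w c y Gc) as (h1 & D1 & S1h & OD1 & D1y & F1).
  destruct (stab_local w (finv c) y Gc') as (h2 & D2 & S2h & OD2 & D2y & F2).
  destruct (oarc_inter D1 D2 y) as (D & OD & Dy & ID); auto.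
  destruct (oarc_near_left D m y OD Dy) as (t & Ht & It); auto.
  (* Elements of the stabilizer agree near [y] with [c] or its inverse; the one that moves [L]
     towards [y] is taken. *)
  assert (Push : forall L, in_arc m y L -> exists e h, G e /\ orient_pres e /\ e y = y /\ in_arc L y (e L) /\
    stab w h /\ forall z, in_arc t y z -> h z = e z).
  { intros L HL; pose proof (Mv L HL) as ML.
    assert (Fy' : finv c y = y) by (rewrite <- Fy at 1; apply finvl; auto).
    destruct (classic (in_arc L y (c L))) as [H|H].
    - exists c, h1; splits; auto; intros z Hz; apply F1, ID; auto.
    - exists (finv c), h2; splits; auto using pres_inv.
      + assert (cLy : c L <> y) by (intro E; rewrite <- Fy in E; apply G_inj in E; auto; subst; circ).
        assert (J : in_arc y L (c L)) by circ.
        apply (pres_arc (finv c)) in J; auto using pres_inv.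
        rewrite Fy', finvl in J by auto; circ.
      + intros z Hz; apply F2, ID; auto. }
  set (P := fun s => in_arc t y s /\ exists k, stab w k /\ forall z, in_arc t y z -> in_arc s y (k z)).
  assert (Step : forall s e h k, s = t \/ in_arc t y s -> orient_pres e -> e y = y -> in_arc t y (e s) -> stab w h ->
    (forall z, in_arc t y z -> h z = e z) -> stab w k -> (forall z, in_arc t y z -> in_arc s y (k z)) -> P (e s)).
  { intros s e h k Hs Oe Ey Hes Sh Fh Sk Fk; split; auto; exists (comp h k); split; [apply stab_comp; auto|].
    intros z Hz; unfold comp; specialize (Fk z Hz); rewrite Fh.
    - rewrite <- Ey; apply pres_arc; auto.
    - destruct Hs as [->|Hs]; auto; circ. }
  (* If pushing stopped at some [L] before [y], then [Push] at [L] would carry a point slightly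
     before [L] beyond it. *)
  assert (All : forall s, in_arc t y s -> P s).
  { destruct (arc_cut t P) as [N|(L & NL & L1 & L2)].
    - intros s s' Hs [Hs1 (k & Sk & Fk)]; split; [circ|]; exists k; split; auto.
      intros z Hz; specialize (Fk z Hz); circ.
    - exists y; split; [circ|]; intros [H _]; circ.
    - exfalso; destruct (Push t Ht) as (e & h & Ge & Oe & Ey & He & Sh & Fh).
      apply (N (e t)); [circ|].
      apply (Step t e h (fun z => z)); auto; split; [apply G_id | apply act_id].
    - destruct (classic (L = y)) as [->|NLy]; [auto|].
      assert (HL : in_arc t y L).
      { apply NNPP; intro N; assert (Py : P y) by (apply L1; circ); destruct Py as [Py _]; circ. }
      exfalso; destruct (Push L) as (e & h & Ge & Oe & Ey & He & Sh & Fh); [circ|].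
      destruct (oarc_near_left (pre e (in_arc L y)) t L) as (s0 & Hs0 & I0); auto.
      { apply pre_oarc; auto; exists L, y; split; auto; tauto. }
      destruct (in_arc_ex s0 L) as [s Hs]; [circ|].
      assert (Hes : in_arc L y (e s)) by (apply (I0 s Hs)).
      assert (Ps : P s) by (apply L1; circ).
      destruct Ps as (Hts & k & Sk & Fk).
      apply (L2 (e s)); [circ|]; apply (Step s e h k); auto; circ. }
  exists (in_arc t y); split; [exists t, y; split; [circ | tauto]|].
  (* Minimality sends [y], hence also a short arc before it, into [E]; the arc from [t] to [y] is
     first pushed into that short arc. *)
  intros E OE; destruct (stab_minimal w y E OE) as (h & Sh & _ & Hh).
  destruct (oarc_near_left (pre h E) t y) as (s & Hs & I); auto.
  { apply pre_oarc; auto; apply Sh. }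
  { circ. }
  destruct (All s Hs) as (_ & k & Sk & Fk).
  exists (comp h k); split; [apply stab_comp; auto|]; intros z Hz; apply (I (k z)); auto.
Qed.

Lemma contractible_nbhd w x : exists A, is_oarc A /\ A x /\ contractible w A.
Proof.
  destruct (contractible_ex w) as (A & OA & CA).
  destruct (stab_minimal w x A OA) as (h & Sh & _ & Hh).
  exists (pre h A); splits; auto; [apply pre_oarc; auto; apply Sh|].
  rewrite <- (finv_finv h) by apply Sh; apply contractible_img_stab; auto using stab_inv.
Qed.

(* [y] is the supremum of the [t] for which the arc [(x, t)] is contractible. *)
Definition reach w x y := x <> y /\
  (forall t, in_arc x y t -> contractible w (in_arc x t)) /\
  (forall t, in_arc y x t -> ~ contractible w (in_arc x t)).

Lemma reach_unique w x y y' : reach w x y -> reach w x y' -> y = y'.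
Proof.
  assert (H : forall y y', reach w x y -> reach w x y' -> ~ in_arc x y y').
  { intros z z' (N & Z & _) (N' & _ & Z') H.
    destruct (in_arc_ex z' z) as [t Ht]; [circ|].
    apply (Z' t); [circ | apply Z; circ]. }
  intros R R'; pose proof (H _ _ R R'); pose proof (H _ _ R' R).
  destruct R as [? _], R' as [? _]; circ.
Qed.

Lemma reach_conj w k x y : G k -> orient_pres k -> reach w x y -> reach (act k w) (k x) (k y).
Proof.
  intros Hk Ok (N & R1 & R2); unfold reach; splits.
  - intro E; apply N, (G_inj k); auto.
  - intros t Ht; rewrite <- (finvr k t) in Ht by auto; apply (pres_arc_iff k) in Ht; auto.
    apply (contractible_mono _ _ (img k (in_arc x (finv k t)))).
    + intros z Hz; unfold img, pre; apply (pres_arc_iff k); auto; rewrite !finvr; auto.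
    + apply contractible_img; auto.
  - intros t Ht C; rewrite <- (finvr k t) in Ht by auto; apply (pres_arc_iff k) in Ht; auto.
    apply (R2 _ Ht); rewrite <- (act_invl k w) by auto.
    apply (contractible_mono _ _ (img (finv k) (in_arc (k x) t))).
    + intros z Hz; unfold img, pre; rewrite finv_finv by auto.
      rewrite <- (finvr k t) by auto; apply pres_arc; auto.
    + apply contractible_img; auto using G_inv.
Qed.

Lemma reach_ex w L : is_oarc L -> ~ contractible w L -> exists x y, reach w x y.
Proof.
  intros (u & v & N & E) C.
  destruct (arc_cut u (fun t => contractible w (in_arc u t))) as [H|(y & Ny & Y1 & Y2)].
  - intros s t Hs; apply contractible_mono; circ.
  - exists v; split; auto; intro C'; apply C; eapply contractible_mono; [|exact C']; intro z; apply E.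
  - exfalso; destruct (contractible_nbhd w u) as (A & OA & Au & CA).
    destruct (oarc_near_right A u v OA Au) as (s & Hs & I); auto.
    apply (H s); [circ|]; eapply contractible_mono; [|exact CA]; auto.
  - exists u, y; unfold reach; splits; auto.
Qed.

(** With both points in [D], either an arc from [x] to beyond [y] lies in [D], or an arc from [x]
    ending before [y] covers the complement of [D]. The first would be contractible past the reach
    of [x]; the second would make the complement contractible. *)
Lemma reach_apart w D x y : is_oarc D -> contractible w D -> ~ contractible w (fun z => ~ D z) ->
  reach w x y -> D x -> D y -> False.
Proof.
  intros (s & t & N & E) C C' (Nxy & R1 & R2) Dx Dy; apply E in Dx, Dy.
  destruct (classic (in_arc s y x)) as [H|H].
  - destruct (in_arc_ex y t) as [u Hu]; [circ|].
    apply (R2 u); [circ|]; eapply contractible_mono; [|exact C]; intro z; rewrite E; circ.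
  - destruct (in_arc_ex s y) as [u Hu]; [circ|].
    apply C'; apply (contractible_mono _ _ (in_arc x u)); [|apply R1; circ].
    intros z Hz; rewrite E in Hz; circ.
Qed.

Lemma not_contractible_compl_img w h D : stab w h -> ~ contractible w (fun z => ~ D z) ->
  ~ contractible w (fun z => ~ img h D z).
Proof.
  intros Sh N C; apply N; apply (contractible_mono _ _ (img (finv h) (fun z => ~ img h D z))).
  - intros z Hz; unfold img, pre; rewrite finv_finv, finvl by apply Sh; auto.
  - apply contractible_img_stab; auto using stab_inv.
Qed.

(** Away from the fixed point [x], [a] acts as an increasing map of a line, which has no cycle of
    length two. *)
Lemma pres_no_two_cycle a x y : orient_pres a -> a x = x -> a y <> y -> y <> x -> a (a y) <> y.
Proof.
  intros Oa Fx My N E.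
  assert (N' : a y <> x) by (intro E'; apply N; rewrite <- E, E'; auto).
  destruct (classic (in_arc x y (a y))) as [H|H].
  - pose proof (pres_arc a _ _ _ Oa H) as H'; rewrite Fx, E in H'; circ.
  - assert (H' : in_arc x (a y) y) by circ.
    pose proof (pres_arc a _ _ _ Oa H') as H''; rewrite Fx, E in H''; circ.
Qed.

Lemma all_contractible w L : is_oarc L -> contractible w L.
Proof.
  intro OL; apply NNPP; intro NL.
  destruct (reach_ex w L OL NL) as (x0 & y0 & R0).
  assert (exists K, is_oarc K /\ contractible w K /\ ~ contractible w (fun z => ~ K z)) as (K & OK & CK & CK').
  { destruct (carc_oarc _ (oarc_compl L OL)) as (B & OB & IB).
    destruct (oarc_ex B OB) as [z Bz].
    destruct (contractible_nbhd w z) as (A & OA & Az & CA).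
    destruct (oarc_inter A B z) as (K & OK & _ & IK); auto; exists K; splits; auto.
    - eapply contractible_mono; [|exact CA]; intros; apply IK; auto.
    - intro C; apply NL; eapply contractible_mono; [|exact C].
      intros u Lu Ku; apply (IB u); auto; apply IK; auto. }
  destruct (oarc_carc K OK) as (B & HB & IB).
  (* The stabilizer brings [y0] to a point moved by [a]; then [reach_apart] keeps the matching [x]
     out of [K]. *)
  assert (Pair : forall a m, Rs B a -> a m <> m -> exists x y, reach w x y /\ ~ K x /\ K y /\ a y <> y).
  { intros a m Ra Hm; destruct (moved_oarc a m (Rs_G _ _ Ra) Hm) as (D & OD & _ & HD).
    destruct (stab_minimal w y0 D OD) as (h & Sh & Oh & Hh).
    assert (My : a (h y0) <> h y0) by (intro E; apply (HD (h y0)); auto; rewrite E; auto).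
    assert (Ky : K (h y0)) by (apply IB, (Rs_moved _ _ _ Ra My)).
    assert (R : reach w (h x0) (h y0)) by (rewrite <- (proj2 Sh); apply reach_conj; auto; apply Sh).
    exists (h x0), (h y0); splits; auto; intro Kx; apply (reach_apart w K (h x0) (h y0)); auto. }
  assert (Fix : forall a x, Rs B a -> ~ K x -> a x = x) by (intros a x [_ Fa] Nx; apply Fa; auto).
  (* [a] fixes [x] and moves [y], so the reach of [x] at [act a w] is [a y], not [y]. *)
  assert (Free : forall a x y, Rs B a -> reach w x y -> ~ K x -> a y <> y -> act a w <> w).
  { intros a x y Ra R Nx My E.
    pose proof (reach_conj w a x y (Rs_G _ _ Ra) (Rs_pres _ _ HB Ra) R) as R'.
    rewrite E, Fix in R' by auto; apply My; apply (reach_unique w x); auto. }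
  destruct (carc_oarc B HB) as (B' & OB' & IB').
  destruct (oarc_two B' OB') as (I & J & HI & HJ & DIJ & II & IJ).
  destruct (Rs_nontrivial I HI) as (a & m & Ra & Ma), (Rs_nontrivial J HJ) as (b & n & Rb & Mb).
  assert (Ra' : Rs B a) by (eapply Rs_mono; [|exact Ra]; auto).
  assert (Rb' : Rs B b) by (eapply Rs_mono; [|exact Rb]; auto).
  pose proof (Rs_G _ _ Ra) as Ga; pose proof (Rs_G _ _ Rb) as Gb.
  destruct (Pair a m Ra' Ma) as (x & y & R & Nx & Ky & My).
  assert (Naa : a (a y) <> y).
  { apply (pres_no_two_cycle a x); auto; [apply (Rs_pres I); auto|]; intros ->; auto. }
  assert (N1 : act a w <> w) by (apply (Free a x y); auto).
  assert (N2 : act b w <> w).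
  { destruct (Pair b n Rb' Mb) as (x' & y' & R' & Nx' & _ & My'); apply (Free b x' y'); auto. }
  (* Otherwise [comp (finv a) b] would fix [w]; it moves [n] because [finv a] fixes [b n], a point
     of [J]. *)
  assert (N3 : act a w <> act b w).
  { intro E. set (c := comp (finv a) b).
    assert (Rc : Rs B c) by (apply Rs_comp; auto using Rs_inv).
    assert (Jn : J n) by (apply (Rs_moved _ _ _ Rb Mb)).
    assert (Mc : c n <> n).
    { unfold c, comp; rewrite (proj2 (Rs_inv _ _ Ra)); auto; intro In; apply (DIJ (b n)); auto.
      apply (Rs_stable J b); auto. }
    destruct (Pair c n Rc Mc) as (x' & y' & R' & Nx' & _ & My').
    apply (Free c x' y'); auto; unfold c; rewrite act_comp, <- E by auto using G_inv; apply act_invl; auto. }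
  assert (N4 : act (comp a a) w <> w) by (apply (Free (comp a a) x y); auto using Rs_comp).
  rewrite act_comp in N4 by auto.
  destruct (H3 w (act a w) (act b w) w (act a w) (act a (act a w))) as (h & Hh & E1 & E2 & E3); auto.
  { intro E; apply N1, (act_inj a); auto. }
  assert (Sh : stab w h) by (split; auto).
  (* The reach of [x] differs at [w], [a w] and [a (a w)], and only an element of the group that moves [x] or [y]
     can change it; so [h I] and [h J] each contain one of [x], [y]. *)
  assert (Near : forall M c e, is_carc M -> Rs M c -> G e -> orient_pres e -> e x = x -> e y <> y ->
     act h (act c w) = act e w -> img h M x \/ img h M y).
  { intros M c e HM Rc Ge Oe Ex My' E; apply NNPP; intro N; apply not_or_and in N as [Nx' Ny'].
    pose proof (Rs_conj M h c Hh Rc) as Rc'.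
    pose proof (reach_conj w (conj_by h c) x y (Rs_G _ _ Rc') (Rs_pres _ _ (img_carc h M Hh HM) Rc') R) as R1.
    rewrite (proj2 Rc' x), (proj2 Rc' y) in R1 by auto.
    rewrite <- E1 in R1 at 1; rewrite act_conj, E in R1 by (auto; apply (Rs_G _ _ Rc)).
    pose proof (reach_conj w e x y Ge Oe R) as R2; rewrite Ex in R2.
    apply My'; apply (reach_unique (act e w) x); auto. }
  assert (Oa : orient_pres a) by (apply (Rs_pres I); auto).
  assert (Fx : a x = x) by auto.
  assert (HIxy : img h I x \/ img h I y) by (apply (Near I a a); auto).
  assert (HJxy : img h J x \/ img h J y).
  { apply (Near J b (comp a a)); auto using G_comp, pres_comp; [unfold comp; rewrite !Fx; auto|].
    rewrite act_comp; auto. }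
  assert (IK : forall z, img h I z -> img h K z) by (unfold img, pre; auto).
  assert (JK : forall z, img h J z -> img h K z) by (unfold img, pre; auto).
  assert (Dh : disjoint (img h I) (img h J)) by (apply img_disjoint; auto).
  (* The images of [I] and [J] are disjoint, so each holds exactly one of [x], [y], and both points
     lie in [img h K]. *)
  apply (reach_apart w (img h K) x y); auto using img_oarc, contractible_img_stab, not_contractible_compl_img.
  - destruct HIxy, HJxy; auto; exfalso; eapply Dh; eauto.
  - destruct HIxy, HJxy; auto; exfalso; eapply Dh; eauto.
Qed.

Lemma carc_contractible w K D : is_carc K -> is_oarc D -> exists h, stab w h /\ forall z, K z -> D (h z).
Proof.
  intros HK OD; destruct (carc_grow K HK) as (L & OL & I).
  destruct (all_contractible w L OL D OD) as (h & Sh & F); exists h; split; auto.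
Qed.

(** * Exchanging an element for one supported off its arc *)

Definition exchangeable w K c := Rs K c /\ exists m, Rs (fun z => ~ K z) m /\ act c w = act m w.

(** [c] commutes with the substitute [n] of [d], so the substitutes multiply in reverse order. *)
Lemma exchangeable_comp w K c d : exchangeable w K c -> exchangeable w K d -> exchangeable w K (comp c d).
Proof.
  intros (Rc & m & Rm & E) (Rd & n & Rn & E'); split; [apply Rs_comp; auto|].
  exists (comp n m); split; [apply Rs_comp; auto|].
  rewrite !act_comp by (eapply Rs_G; eauto); rewrite E', <- E.
  apply (act_commute K (fun z => ~ K z)); auto; intros z ? ?; auto.
Qed.

Lemma exchangeable_inv w K c : exchangeable w K c -> exchangeable w K (finv c).
Proof.
  intros (Rc & m & Rm & E); split; [apply Rs_inv; auto|].
  exists (finv m); split; [apply Rs_inv; auto|].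
  pose proof (Rs_G _ _ Rc); pose proof (Rs_G _ _ Rm).
  apply (act_inj c); auto; rewrite act_invr by auto.
  rewrite (act_commute K (fun z => ~ K z)); auto using Rs_inv; [|intros z ? ?; auto].
  rewrite E, act_invl; auto.
Qed.

(** An element of the stabilizer of [w] contracts [K] into [K']; a substitute supported off [K'],
    conjugated back, is supported off [K]. *)
Lemma not_exchangeable_everywhere w K K' c : is_carc K -> Rs K c -> ~ exchangeable w K c -> is_carc K' ->
  exists c', Rs K' c' /\ ~ exchangeable w K' c'.
Proof.
  intros HK Rc Nc HK'; destruct (carc_oarc K' HK') as (D & OD & ID).
  destruct (carc_contractible w K D HK OD) as (h & Sh & F).
  pose proof (Rs_G _ _ Rc) as Gc; destruct Sh as [Hh Eh].
  assert (I : forall z, img h K z -> K' z).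
  { intros z Hz; apply ID; rewrite <- (finvr h z) by auto; apply F, Hz. }
  exists (conj_by h c); split; [eapply Rs_mono; [exact I | apply Rs_conj; auto]|].
  intros (_ & m & Rm & E); apply Nc; split; auto.
  exists (conj_by (finv h) m); split.
  - eapply Rs_mono; [|apply Rs_conj; [apply G_inv; auto | exact Rm]].
    intros z Hz Kz; apply Hz; unfold pre; rewrite finv_finv by auto; apply ID, F, Kz.
  - assert (Ei : act (finv h) w = w) by (apply act_fix_inv; auto).
    rewrite <- Eh in E at 1; rewrite act_conj in E by auto.
    rewrite <- Ei at 2; rewrite act_conj by (auto using G_inv; apply (Rs_G _ _ Rm)).
    rewrite <- E, act_invl; auto.
Qed.

Lemma carc_two_disjoint K : is_carc K ->
  exists K1 K2, is_carc K1 /\ is_carc K2 /\ disjoint K1 K2 /\ disjoint K1 K /\ disjoint K2 K.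
Proof.
  intro HK; destruct (oarc_two _ (carc_compl K HK)) as (K1 & K2 & ? & ? & ? & I1 & I2).
  exists K1, K2; splits; auto.
Qed.

(** Otherwise place non-exchangeable [c1], [c2] on two further disjoint arcs. Then [w] and its
    images under [c1 c2 c] and [c1 c2 d] are joined by two elements with disjoint supports, and by
    [three_arcs] one of these supports misses one of the three arcs, making the factor there
    exchangeable. *)
Lemma not_exchangeable_same w K c d : is_carc K -> Rs K c -> Rs K d ->
  ~ exchangeable w K c -> ~ exchangeable w K d -> act c w = act d w.
Proof.
  intros HK Rc Rd Nc Nd; apply NNPP; intro Ncd.
  destruct (carc_two_disjoint K HK) as (K1 & K2 & H1 & H2 & D12 & D1 & D2).
  destruct (not_exchangeable_everywhere w K K1 c) as (c1 & R1 & N1); auto.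
  destruct (not_exchangeable_everywhere w K K2 c) as (c2 & R2 & N2); auto.
  pose proof (Rs_G _ _ Rc); pose proof (Rs_G _ _ Rd); pose proof (Rs_G _ _ R1); pose proof (Rs_G _ _ R2).
  assert (S : forall A B, disjoint A B -> disjoint B A) by (intros A B D z ? ?; apply (D z); auto).
  assert (Off : forall M A a, disjoint A M -> Rs A a -> Rs (fun z => ~ M z) a).
  { intros M A a D; apply Rs_mono; intros z Az Mz; apply (D z); auto. }
  (* If [act m w = act (c1 c2 e) w] with [m] supported off one of the three arcs, the factor on that arc is exchangeable. *)
  assert (X : forall e m, Rs K e -> ~ exchangeable w K e -> G m -> act m w = act c1 (act c2 (act e w)) ->
     ~ Rs (fun z => ~ K1 z) m /\ ~ Rs (fun z => ~ K2 z) m /\ ~ Rs (fun z => ~ K z) m).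
  { intros e m Re Ne Gm E; pose proof (Rs_G _ _ Re); splits; intro Rm.
    - apply N1; split; auto; exists (comp (finv (comp c2 e)) m).
      assert (R : Rs (fun z => ~ K1 z) (comp c2 e)) by (apply Rs_comp; eauto).
      split; [apply Rs_comp; auto using Rs_inv|].
      rewrite (act_comp (finv _)), E by auto using G_inv, G_comp.
      rewrite <- (act_comp c2), (act_commute K1 (fun z => ~ K1 z) c1), act_invl; auto using G_comp.
      intros z ? ?; auto.
    - apply N2; split; auto; exists (comp (finv (comp c1 e)) m).
      assert (R : Rs (fun z => ~ K2 z) (comp c1 e)) by (apply Rs_comp; eauto).
      split; [apply Rs_comp; auto using Rs_inv|].
      rewrite (act_comp (finv _)), E by auto using G_inv, G_comp.
      rewrite (act_commute K2 K c2 e) by auto.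
      rewrite <- (act_comp c1), <- (act_comp (comp c1 e)) by auto using G_comp.
      rewrite act_comp, act_invl; auto using G_comp.
    - apply Ne; split; auto; exists (comp (finv (comp c1 c2)) m).
      assert (R : Rs (fun z => ~ K z) (comp c1 c2)) by (apply Rs_comp; eauto).
      split; [apply Rs_comp; auto using Rs_inv|].
      rewrite (act_comp (finv _)), E by auto using G_inv, G_comp.
      rewrite <- (act_comp c1), act_invl; auto using G_comp. }
  (* The identity is supported off every arc, so it can play the part of [m]. *)
  assert (NW : forall e, Rs K e -> ~ exchangeable w K e -> w <> act c1 (act c2 (act e w))).
  { intros e Re Ne E; destruct (X e (fun z => z)) as (N & _ & _); auto using G_id.
    - rewrite act_id; auto.
    - apply N; split; auto using G_id. }
  destruct (separated_triples w (act c1 (act c2 (act c w))) (act c1 (act c2 (act d w))))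
    as (U & V & a & b & HU & HV & DUV & Ra & Rb & Ea & Eb); auto.
  { intro E; apply Ncd; apply (act_inj c2), (act_inj c1); auto. }
  destruct (X c a) as (A1 & A2 & A3); auto; [apply (Rs_G _ _ Ra)|].
  destruct (X d b) as (B1 & B2 & B3); auto; [apply (Rs_G _ _ Rb)|].
  destruct (three_arcs K1 K2 K U V) as [[D|D]|[[D|D]|[D|D]]]; eauto.
Qed.

(** Neither [d] nor [comp d e] is exchangeable, so they agree at [w]. *)
Lemma exchangeable_fixes w K d e : is_carc K -> Rs K d -> ~ exchangeable w K d ->
  exchangeable w K e -> act e w = w.
Proof.
  intros HK Rd Nd Xe; pose proof (proj1 Xe) as Re.
  pose proof (Rs_G _ _ Rd); pose proof (Rs_G _ _ Re).
  assert (N : ~ exchangeable w K (comp d e)).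
  { intro X; apply Nd; replace d with (comp (comp d e) (finv e)).
    - apply exchangeable_comp; auto using exchangeable_inv.
    - extensionality z; unfold comp; rewrite finvr; auto. }
  pose proof (not_exchangeable_same w K d (comp d e) HK Rd (Rs_comp _ _ _ Rd Re) Nd N) as E.
  rewrite act_comp in E by auto; symmetry; apply (act_inj d); auto.
Qed.

(** Exchanging with respect to the complement of an open arc inside [L] forces the substitute into
    [L]. *)
Lemma exchangeable_onto w K L c : (forall B e, is_carc B -> Rs B e -> exchangeable w B e) ->
  is_carc L -> disjoint L K -> Rs K c -> exists l, Rs L l /\ act c w = act l w.
Proof.
  intros X HL D Rc; destruct (carc_oarc L HL) as (O & OO & IO).
  destruct (X (fun z => ~ O z) c) as (_ & m & Rm & E).
  - apply oarc_compl; auto.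
  - eapply Rs_mono; [|exact Rc]; intros z Kz Oz; apply (D z); auto.
  - exists m; split; auto; eapply Rs_mono; [|exact Rm].
    intros z Hz; apply IO, NNPP, Hz.
Qed.

Lemma separated_moves_absurd : False.
Proof.
  destruct HS as (w & _); apply (commuting_at_absurd w); intros K a b HK Ra Rb.
  pose proof (Rs_G _ _ Ra) as Ga; pose proof (Rs_G _ _ Rb) as Gb.
  destruct (classic (forall B e, is_carc B -> Rs B e -> exchangeable w B e)) as [X|N].
  (* At [w], [a] and [b] are traded for [l] and [m] on disjoint arcs away from [K]; [l] and [m]
     commute with each other and with [a] and [b]. *)
  - destruct (carc_two_disjoint K HK) as (L & M & HL & HM & DLM & DL & DM).
    destruct (exchangeable_onto w K L a) as (l & Rl & El); auto.
    destruct (exchangeable_onto w K M b) as (m & Rm & Em); auto.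
    rewrite Em, El, <- (act_commute M K m a), <- (act_commute L K l b), El, Em by auto.
    symmetry; apply (act_commute L M); auto.
  (* Now the exchangeable elements of [Rs K] fix [w], and all the others send [w] to one and the
     same point. *)
  - assert (exists d, Rs K d /\ ~ exchangeable w K d) as (d & Rd & Nd).
    { apply NNPP; intro N'; apply N; intros B e HB Re; apply NNPP; intro Ne; apply N'.
      apply (not_exchangeable_everywhere w B K e); auto. }
    destruct (classic (exchangeable w K a)) as [Xa|Na], (classic (exchangeable w K b)) as [Xb|Nb].
    + rewrite !(exchangeable_fixes w K d _ HK Rd Nd) by auto; auto.
    + assert (Nab : ~ exchangeable w K (comp a b)).
      { intro X; apply Nb; replace b with (comp (finv a) (comp a b)).
        - apply exchangeable_comp; auto using exchangeable_inv.
        - extensionality z; unfold comp; rewrite finvl; auto. }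
      rewrite (exchangeable_fixes w K d a), <- (act_comp a b) by auto.
      apply (not_exchangeable_same w K); auto using Rs_comp.
    + assert (Nba : ~ exchangeable w K (comp b a)).
      { intro X; apply Na; replace a with (comp (finv b) (comp b a)).
        - apply exchangeable_comp; auto using exchangeable_inv.
        - extensionality z; unfold comp; rewrite finvl; auto. }
      rewrite (exchangeable_fixes w K d b), <- (act_comp b a) by auto.
      apply (not_exchangeable_same w K); auto using Rs_comp.
    (* The inverse of a non-exchangeable [c] is not exchangeable either, so it also sends [w] to
       [act a w]. *)
    + assert (Inv : forall c, Rs K c -> ~ exchangeable w K c -> act c (act a w) = w).
      { intros c Rc Nc; pose proof (Rs_G _ _ Rc).
        rewrite (not_exchangeable_same w K a (finv c)); auto using Rs_inv, act_invr.
        intro X; apply Nc; rewrite <- (finv_finv c) by auto; apply exchangeable_inv; auto. }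
      rewrite (not_exchangeable_same w K b a), !Inv; auto.
Qed.
End SeparatedMoves.

Lemma Rs_moves_point K : is_carc K -> exists a p, Rs K a /\ act a p <> p.
Proof.
  intro HK; destruct (Rs_nontrivial K HK) as (a & x & Ra & Hx); exists a; apply NNPP; intro N.
  apply Hx, HF; [apply (Rs_G _ _ Ra)|]; intro p; apply NNPP; eauto.
Qed.

(** An endpoint of [I] is off [J], so just outside [I] there is room for another arc. *)
Lemma carc_disjoint_from_two I J : is_carc I -> is_carc J -> disjoint I J ->
  exists A, is_carc A /\ disjoint A I /\ disjoint A J.
Proof.
  intros HI HJ D; destruct (carc_compl I HI) as (s & t & N & E).
  assert (Ns : ~ J s).
  { intro Js; apply (D s); auto; apply NNPP; intro H; apply E in H; circ. }
  destruct (oarc_near_right (fun z => ~ J z) s t) as (u & Hu & F); auto using carc_compl.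
  destruct (oarc_inter (fun z => ~ I z) (fun z => ~ J z) u) as (B & OB & _ & S); auto using carc_compl.
  { apply E; auto. }
  destruct (oarc_carc B OB) as (A & HA' & IA).
  exists A; splits; auto; intros z Az; apply IA, S in Az; tauto.
Qed.

(** * The core of a point of [Omega] *)

Section NoSeparatedMoves.
Hypothesis NS : ~ separated_moves.

Lemma moves_agree w I J a b : is_carc I -> is_carc J -> disjoint I J -> Rs I a -> Rs J b ->
  act a w <> w -> act b w <> w -> act a w = act b w.
Proof. intros; apply NNPP; intro; apply NS; exists w, I, J, a, b; splits; auto. Qed.

Lemma disjoint_sym A B : disjoint A B -> disjoint B A.
Proof. intros D z ? ?; apply (D z); auto. Qed.

(** If both moved [w], every element supported in a third arc [A] disjoint from [I] and [J] would
    act trivially on [Omega], against faithfulness. *)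
Lemma one_fixes w I J a b : is_carc I -> is_carc J -> disjoint I J -> Rs I a -> Rs J b ->
  act a w = w \/ act b w = w.
Proof.
  intros HI HJ D Ra Rb; apply NNPP; intro N; apply not_or_and in N as [Na Nb].
  pose proof (moves_agree w I J a b HI HJ D Ra Rb Na Nb) as Eab.
  destruct (carc_disjoint_from_two I J) as (A & HA' & DI & DJ); auto.
  assert (Triv : forall c p, Rs A c -> act c p = p).
  { intros c p Rc.
    assert (Tw : forall p, p <> w -> p <> act a w -> act c w = w /\ act c p = p).
    { clear p; intros p Np Np'.
      (* Conjugation by [h] gives elements on disjoint arcs [U], [V] sending [w] to [p]. If one of
         these arcs missed [I] or [J], then [p = act a w] would follow; so [three_arcs] leaves an
         arc missing [A]. *)
      destruct (two_transitive w (act a w) w p) as (h & Hh & E1 & E2); auto.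
      pose proof (Rs_G _ _ Ra) as Ga; pose proof (Rs_G _ _ Rb) as Gb.
      assert (Ea : act (conj_by h a) w = p) by (rewrite <- E1 at 1; rewrite act_conj; auto).
      assert (Eb : act (conj_by h b) w = p) by (rewrite <- E1 at 1; rewrite act_conj, <- Eab; auto).
      pose proof (Rs_conj I h a Hh Ra) as Ra'; pose proof (Rs_conj J h b Hh Rb) as Rb'.
      set (U := img h I) in *; set (V := img h J) in *.
      assert (HU : is_carc U) by (apply img_carc; auto). assert (HV : is_carc V) by (apply img_carc; auto).
      assert (NotAgree : forall W M e f, is_carc W -> is_carc M -> disjoint W M -> Rs W e -> Rs M f ->
        act e w = p -> act f w <> w -> act f w <> p -> False).
      { intros W M e f HW HM DM Re Rf Ee Nf Nf'; apply Nf'; rewrite <- Ee; symmetry.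
        apply (moves_agree w W M); auto; rewrite Ee; auto. }
      (* If [c] moved [w], it would agree there with both [e] and [a], whose values differ; fixing
         [w] and commuting with [e], it fixes [p] too. *)
      assert (Off : forall W e, is_carc W -> disjoint W A -> Rs W e -> act e w = p -> act c w = w /\ act c p = p).
      { intros W e HW DW Re Ee.
        assert (Ec : act c w = w).
        { apply NNPP; intro Nc; apply (NotAgree W A e c); auto.
          rewrite (moves_agree w A I c a); auto. }
        split; auto; rewrite <- Ee, <- (act_commute W A e c), Ec; auto. }
      assert (DUV : disjoint U V) by (apply img_disjoint; auto).
      assert (Nb' : act b w <> p) by (rewrite <- Eab; auto).
      destruct (three_arcs I J A U V) as [[H|H]|[[H|H]|[H|H]]]; auto using disjoint_sym.
      - exfalso; apply (NotAgree U I (conj_by h a) a); auto.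
      - exfalso; apply (NotAgree V I (conj_by h b) a); auto.
      - exfalso; apply (NotAgree U J (conj_by h a) b); auto.
      - exfalso; apply (NotAgree V J (conj_by h b) b); auto.
      - apply (Off U (conj_by h a)); auto.
      - apply (Off V (conj_by h b)); auto. }
    destruct (third_point w (act a w)) as (r & Nr & Nr').
    destruct (Tw r Nr Nr') as [Ew _].
    destruct (classic (p = w)) as [->|Np]; auto.
    destruct (classic (p = act a w)) as [->|Np']; [|apply Tw; auto].
    rewrite (act_commute A I c a), Ew; auto. }
  destruct (Rs_moves_point A HA') as (c & p & Rc & Nc); auto.
Qed.

Definition moved_by w L := is_carc L /\ exists a, Rs L a /\ act a w <> w.

Definition remote w U := is_carc U /\ exists L, moved_by w L /\ disjoint L U.

(** In the model where [Omega] is an orbit in the circle, arcs moving [w] contain it and remote arcs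
    miss it, so the core contains [w]. *)
Definition core w z := forall U c, remote w U -> Rs U c -> c z = z.

Lemma moved_by_mono w (L L' : S1 -> Prop) : is_carc L' -> (forall z, L z -> L' z) -> moved_by w L -> moved_by w L'.
Proof. intros H I (_ & a & Ra & Na); split; auto; exists a; split; auto; eapply Rs_mono; eauto. Qed.

Lemma moved_by_img w L g : G g -> moved_by w L -> moved_by (act g w) (img g L).
Proof.
  intros Hg (HL & a & Ra & Na); split; [apply img_carc; auto|].
  exists (conj_by g a); split; [apply Rs_conj; auto|].
  rewrite act_conj by (auto; apply (Rs_G _ _ Ra)); intro E; apply Na, (act_inj g); auto.
Qed.

Lemma remote_img w U g : G g -> remote w U -> remote (act g w) (img g U).
Proof.
  intros Hg (HU & L & ML & D); split; [apply img_carc; auto|].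
  exists (img g L); split; [apply moved_by_img; auto | apply img_disjoint; auto].
Qed.

Lemma remote_fixes w U c : remote w U -> Rs U c -> act c w = w.
Proof.
  intros (HU & L & (HL & a & Ra & Na) & D) Rc.
  destruct (one_fixes w L U a c) as [E|E]; auto; contradiction.
Qed.

Lemma remote_not_moved w U : remote w U -> ~ moved_by w U.
Proof. intros RU (_ & a & Ra & Na); apply Na, (remote_fixes w U); auto. Qed.

Lemma core_img w z g : G g -> core w z -> core (act g w) (g z).
Proof.
  intros Hg C U c RU Rc.
  assert (F : conj_by (finv g) c z = z).
  { apply (C (img (finv g) U)); [|apply Rs_conj; auto using G_inv].
    rewrite <- (act_invl g w) by auto; apply remote_img; auto using G_inv. }
  unfold conj_by, comp in F; rewrite finv_finv in F by auto.
  rewrite <- F at 2; rewrite finvr; auto.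
Qed.

Lemma core_img_inv w z g : G g -> core (act g w) z -> core w (finv g z).
Proof. intros Hg C; rewrite <- (act_invl g w) by auto; apply core_img; auto using G_inv. Qed.

(** Elements [a], [b] on disjoint arcs move points [v], [v'], and [a] fixes [v'] by [one_fixes]. The
    triple [v], [act a v], [v'] is then carried to [p], [q], [w]. *)
Lemma remote_transitive p q w : p <> q -> p <> w -> q <> w ->
  exists U u, remote w U /\ Rs U u /\ act u p = q.
Proof.
  intros N1 N2 N3; destruct carc_ex as [K HK].
  destruct (oarc_two _ (carc_compl K HK)) as (I & J & HI & HJ & D & _ & _).
  destruct (Rs_moves_point I HI) as (a & v & Ra & Na), (Rs_moves_point J HJ) as (b & v' & Rb & Nb).
  assert (Ea : act a v' = v') by (destruct (one_fixes v' I J a b); auto; contradiction).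
  assert (Nv : v <> v') by (intros ->; auto).
  pose proof (Rs_G _ _ Ra) as Ga.
  assert (Nv' : act a v <> v') by (intro E; apply Nv, (act_inj a); auto; congruence).
  destruct (H3 v (act a v) v' p q w) as (g & Hg & E1 & E2 & E3); auto.
  exists (img g I), (conj_by g a); splits.
  - split; [apply img_carc; auto|]; exists (img g J); split; [|apply img_disjoint, disjoint_sym; auto].
    rewrite <- E3; apply moved_by_img; auto; split; eauto.
  - apply Rs_conj; auto.
  - rewrite <- E1, act_conj; auto.
Qed.

Lemma remote_ex w : exists U, remote w U.
Proof.
  destruct (third_point w w) as (p & Np & _), (third_point w p) as (q & Nq & Nq').
  destruct (remote_transitive p q w) as (U & _ & ? & _); eauto.
Qed.

Lemma core_misses_oarc w : exists D, is_oarc D /\ forall z, core w z -> ~ D z.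
Proof.
  destruct (remote_ex w) as [U RU]; destruct (Rs_nontrivial U (proj1 RU)) as (u & m & Ru & Hm).
  destruct (moved_oarc u m (Rs_G _ _ Ru) Hm) as (D & OD & _ & F).
  exists D; split; auto; intros z C Dz; apply (F z Dz); rewrite (C U u RU Ru); auto.
Qed.

(* The remote groups at [w] fix [z] and act transitively on the other points, so a common core point would be
   a core point of every element of [Omega]. *)
Lemma core_disjoint p w z : core p z -> core w z -> p = w.
Proof.
  intros Cp Cw; apply NNPP; intro N.
  assert (All : forall q, core q z).
  { intro q; destruct (classic (q = w)) as [->|Nw]; auto.
    destruct (classic (p = q)) as [<-|Nq]; auto.
    destruct (remote_transitive p q w) as (U & u & RU & Ru & <-); auto.
    rewrite <- (Cw U u RU Ru); apply core_img; auto; apply (Rs_G _ _ Ru). }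
  destruct (core_misses_oarc w) as (D & OD & F).
  destruct (minimal_pres z D OD) as (g & Hg & _ & Dg).
  apply (F (g z)); auto; rewrite <- (act_invr g w) by auto; apply core_img; auto.
Qed.

(* For [x] an endpoint of an arc moving [w], the infimum of the [t] such that [[x, t]] moves [w] is a core point. *)
Lemma core_ex w : exists z, core w z.
Proof.
  destruct carc_ex as [K0 HK0]; destruct (Rs_moves_point K0 HK0) as (a & v & Ra & Na).
  destruct (transitive v w) as (g & Hg & Eg).
  assert (M0 : moved_by w (img g K0)) by (rewrite <- Eg; apply moved_by_img; auto; split; eauto).
  set (L := img g K0) in *; destruct (proj1 M0) as (x & b & Nxb & EL).
  set (cl := fun t z => ~ in_arc t x z).
  assert (Hcl : forall t, t <> x -> is_carc (cl t)) by (intros t Nt; exists x, t; split; auto; unfold cl; tauto).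
  assert (Up : forall t U, remote w U -> moved_by w (cl t) -> (forall z, cl t z -> U z) -> False).
  { intros t U RU M I; apply (remote_not_moved w U RU), (moved_by_mono w (cl t)); auto; apply RU. }
  assert (Interior : forall U c z, Rs U c -> c z <> z -> exists D, is_oarc D /\ D z /\ forall u, D u -> U u).
  { intros U c z Rc Mz; destruct (moved_oarc c z (Rs_G _ _ Rc) Mz) as (D & OD & Dz & F).
    exists D; splits; auto; intros u Du; apply (Rs_moved _ _ _ Rc); intro E; apply (F u Du); rewrite E; auto. }
  destruct (arc_cut x (fun t => t <> x /\ ~ moved_by w (cl t))) as [H|(y & Ny & Y1 & Y2)].
  - intros s t Hs [Nt Mt]; split; [circ|]; intro M; apply Mt.
    apply (moved_by_mono w (cl s)); auto; unfold cl; circ.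
  - exists b; split; auto; intros [_ M]; apply M; apply (moved_by_mono w L); auto; intro z; apply EL.
  (* Here all arcs starting at [x] move [w], and a remote arc containing a neighbourhood of [x]
     would contain one of them. *)
  - exists x; intros U c RU Rc; apply NNPP; intro Mx.
    destruct (Interior U c x Rc Mx) as (D & OD & Dx & I).
    destruct (oarc_near_right D x b OD Dx) as (t & Ht & It); auto.
    assert (Nt : t <> x) by circ.
    apply (Up t U RU); [apply NNPP; intro M; apply (H t); auto|].
    intros z Hz; apply I; destruct (classic (z = x)) as [->|Nz]; auto; apply It; unfold cl in Hz.
    destruct (classic (z = t)); auto; left; circ.
  - exists y; intros U c RU Rc; apply NNPP; intro My.
    assert (M1 : forall t, in_arc x y t -> ~ moved_by w (cl t)) by (intros t Ht; apply Y1; auto).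
    assert (M2 : forall t, in_arc y x t -> moved_by w (cl t)).
    { intros t Ht; apply NNPP; intro M; apply (Y2 t Ht); split; auto; circ. }
    destruct (Interior U c y Rc My) as (D & OD & Dy & I).
    destruct (classic (U x)) as [Ux|Ux].
    (* The complement of [U] is one arc missing [x] and [y], so [L'] lies on one side of them. On
       the first side, [L'] is inside some [[x, t0]] with [t0] before [y]; on the second, [U]
       contains some [[x, t0]] with [t0] beyond [y]. *)
    + pose proof RU as (HU & L' & ML' & DL').
      destruct (carc_compl U HU) as (s & t & Nst & EU).
      assert (Sx : ~ in_arc s t x) by (rewrite <- EU; auto).
      assert (Sy : ~ in_arc s t y) by (rewrite <- EU; intro F; apply F; auto).
      assert (IL : forall z, L' z -> in_arc s t z) by (intros z Lz; apply EU; intro Uz; apply (DL' z); auto).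
      assert (Side : (forall z, in_arc s t z -> in_arc x y z) \/ (forall z, in_arc s t z -> in_arc y x z)) by (apply arc_one_side; auto).
      destruct Side as [S|S].
      * destruct (oarc_near_left D x y OD Dy) as (t0 & Ht0 & It); auto.
        apply (M1 t0 Ht0); apply (moved_by_mono w L'); auto; [apply Hcl; circ|].
        intros z Lz; unfold cl; intro Hz.
        assert (Hxy : in_arc x y z) by auto.
        assert (Dz : D z) by (apply It; clear - Hz Hxy Ht0; circ).
        apply (DL' z); auto.
      * destruct (oarc_near_right D y x OD Dy) as (t0 & Ht0 & It); auto.
        apply (Up t0 U RU (M2 t0 Ht0)); intros z Hz; apply NNPP; intro Uz.
        assert (Hyx : in_arc y x z) by (apply S, EU; auto).
        apply Uz, I, It; destruct (classic (z = t0)); auto; left.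
        clear - Hz Hyx Ht0 H; unfold cl in Hz; circ.
    (* [Rs U] fixes [x], and some [e] in it moves [y] backwards. It takes [[x, t]], for [t] just
       after [y], to an arc ending before [y]; as [e] fixes [w], that arc moves [w] as well. *)
    + assert (Fx : forall e, Rs U e -> e x = x) by (intros e [_ F]; auto).
      assert (E : exists e, Rs U e /\ in_arc x y (e y)).
      { destruct (classic (in_arc x y (c y))) as [H|H]; [eauto|].
        exists (finv c); split; [apply Rs_inv; auto|].
        assert (Gc : G c) by apply (Rs_G _ _ Rc).
        assert (Nx : c y <> x) by (intro E; rewrite <- (Fx c Rc) in E; apply G_inj in E; auto).
        assert (J : in_arc x (c y) y) by circ.
        apply (pres_arc (finv c)) in J; [|apply pres_inv; auto; apply (Rs_pres U); auto; apply RU].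
        rewrite finvl, (Fx (finv c)) in J by auto using Rs_inv; auto. }
      destruct E as (e & Re & He); pose proof (Rs_G _ _ Re) as Ge.
      assert (Oe : orient_pres e) by (apply (Rs_pres U); auto; apply RU).
      destruct (oarc_near_right (pre e (in_arc x y)) y x) as (t & Ht & It); auto.
      { apply pre_oarc; auto; exists x, y; split; auto; tauto. }
      assert (Het : in_arc x y (e t)) by (apply (It t); auto).
      apply (M1 (e t) Het); apply (moved_by_mono w (img e (cl t))).
      * apply Hcl; circ.
      * intros z Hz Hz'; apply Hz; rewrite (pres_arc_iff e) by auto; rewrite finvr, Fx; auto.
      * rewrite <- (remote_fixes w U e) at 1 by auto; apply moved_by_img; auto.
Qed.

(** Proximality squeezes the complement of an arc missed by the core into [T]. *)
Lemma core_in_oarc (w : Omega) T : is_oarc T -> exists p, forall z, core p z -> T z.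
Proof.
  intro OT; destruct (core_misses_oarc w) as (D & OD & F).
  destruct (proximal (fun z => ~ D z) T) as (g & Hg & H); auto using oarc_compl.
  exists (act g w); intros z C; rewrite <- (finvr g z) by auto; apply H, F, core_img_inv; auto.
Qed.

(* If the core of [w] had two points, then [w] would separate the cores of some [p] and [r]; by
   3-transitivity [p] would also separate the cores of [w] and [r]. *)
Lemma core_unique w x y : core w x -> core w y -> x = y.
Proof.
  intros Cx Cy; apply NNPP; intro N.
  destruct (core_in_oarc w (in_arc x y)) as [p Ip]; [exists x, y; tauto|].
  destruct (core_in_oarc w (in_arc y x)) as [r Ir]; [exists y, x; split; [auto | tauto]|].
  assert (Npw : p <> w) by (intros ->; specialize (Ip x Cx); circ).
  assert (Nrw : r <> w) by (intros ->; specialize (Ir x Cx); circ).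
  destruct (core_ex r) as [z Cz].
  assert (Npr : p <> r) by (intros ->; specialize (Ip z Cz); specialize (Ir z Cz); circ).
  destruct (H3 w p r p w r) as (g & Hg & E1 & E2 & E3); auto.
  assert (Px : in_arc x y (g x)) by (apply Ip; rewrite <- E1; apply core_img; auto).
  assert (Py : in_arc x y (g y)) by (apply Ip; rewrite <- E1; apply core_img; auto).
  assert (Qx : in_arc x y (finv g x)) by (apply Ip, core_img_inv; auto; rewrite E2; auto).
  assert (Qy : in_arc x y (finv g y)) by (apply Ip, core_img_inv; auto; rewrite E2; auto).
  assert (Qz : in_arc y x (finv g z)) by (apply Ir, core_img_inv; auto; rewrite E3; auto).
  specialize (Ir z Cz).
  (* After applying [g], the points [g x] and [g y] separate [z] from [x] and [y], although both lie
     in the arc from [x] to [y] and [z] lies in the opposite one. *)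
  destruct (G_orient g Hg) as [O|O]; apply O in Qx, Qy, Qz; rewrite finvr in Qx, Qy, Qz by auto;
    unfold cyc in *; clear - Px Py Qx Qy Qz Ir; circ.
Qed.

Lemma conjugate_to_orbit : exists z, conj_to_orbit G Omega act z.
Proof.
  (* A moved point of [Omega] serves as base point of the orbit. *)
  destruct carc_ex as [K HK]; destruct (Rs_moves_point K HK) as (_ & w0 & _).
  set (phi := fun w => proj1_sig (constructive_indefinite_description _ (core_ex w))).
  assert (Hphi : forall w, core w (phi w)).
  { intro w; unfold phi; destruct constructive_indefinite_description; auto. }
  assert (Eq : forall g w, G g -> phi (act g w) = g (phi w)).
  { intros g w Hg; apply (core_unique (act g w)); auto; apply core_img; auto. }
  exists (phi w0), phi; splits; auto.
  - intro w; destruct (transitive w0 w) as (g & Hg & <-); eauto.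
  - intros g Hg; exists (act g w0); auto.
  - intros w1 w2 E; apply (core_disjoint w1 w2 (phi w1)); auto; rewrite E; auto.
Qed.
End NoSeparatedMoves.

End Group.

Theorem theorem1p1 (G : (S1 -> S1) -> Prop) :
  homeo_subgroup G ->
  minimal_action G ->
  proximal_action G ->
  ~ top_free G ->
  stab_plus_injective G ->
  forall (Omega : Type) (act : (S1 -> S1) -> Omega -> Omega),
    is_action G Omega act ->
    faithful_action G Omega act ->
    three_transitive G Omega act ->
    exists z : S1, conj_to_orbit G Omega act z.
Proof.
  intros HG _ Hprox Htf _ Omega act HA HF H3.
  apply conjugate_to_orbit; auto.
  intro HS; eapply separated_moves_absurd; eauto.
Qed.
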